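(* Let $[a,b]$ be a real interval. (i) Let $\alpha,\beta\in\mathbb{C}$ with $\mathrm{Re}(\alpha)>0$ and $\mathrm{Re}(\beta)\ge 0$, and let $f\in L^1[a,b]$. Then for almost every $t\in[a,b]$ the following series converges and $$ {}^{T}_{a}I^{(\alpha,\beta)}_t f(t)=\sum_{m=0}^{\infty}\frac{(-\beta)^m\,\Gamma(\alpha+m)}{m!\,\Gamma(\alpha)}\;{}^{RL}_{a}I^{\alpha+m}_t f(t). $$ (ii) Let $\alpha,\beta\in\mathbb{C}$ with $\mathrm{Re}(\alpha)\ge 0$ and $\mathrm{Re}(\beta)\ge 0$, let $n=\lfloor \mathrm{Re}(\alpha)\rfloor+1$, and let $f\in C^n[a,b]$. Then for every $t\in(a,b]$ the following series converges and $$ {}^{T}_{a}D^{(\alpha,\beta)}_t f(t)=\sum_{m=0}^{\infty}\frac{(-\beta)^m\,\Gamma(-\alpha+m)}{m!\,\Gamma(-\alpha)}\;{}^{RL}_{a}I^{-\alpha+m}_t f(t). $$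
   Context: Riemann--Liouville operators: for $\mathrm{Re}(\nu)>0$, ${}^{RL}_{a}I^{\nu}_t f(t)=\frac{1}{\Gamma(\nu)}\int_a^t (t-u)^{\nu-1}f(u)\,du$; for $\mathrm{Re}(\nu)\ge 0$, ${}^{RL}_{a}D^{\nu}_t f(t)=\frac{d^k}{dt^k}\,{}^{RL}_{a}I^{k-\nu}_t f(t)$ with $k=\lfloor\mathrm{Re}(\nu)\rfloor+1$. For $\mathrm{Re}(\nu)\le 0$ the convention is ${}^{RL}_{a}I^{\nu}_t f={}^{RL}_{a}D^{-\nu}_t f$. Tempered fractional integral: for $\mathrm{Re}(\alpha)>0$, $\mathrm{Re}(\beta)\ge0$, $f\in L^1[a,b]$, $${}^{T}_{a}I^{(\alpha,\beta)}_t f(t)=\frac{1}{\Gamma(\alpha)}\int_a^t (t-u)^{\alpha-1}e^{-\beta(t-u)}f(u)\,du.$$ Tempered fractional derivative: for $\mathrm{Re}(\alpha)\ge0$, $\mathrm{Re}(\beta)\ge0$, $n=\lfloor\mathrm{Re}(\alpha)\rfloor+1$, $f\in C^n[a,b]$, $${}^{T}_{a}D^{(\alpha,\beta)}_t f(t)=\left(\frac{d}{dt}+\beta\right)^n\left({}^{T}_{a}I^{(n-\alpha,\beta)}_t f(t)\right).$$ The quotient $\Gamma(-\alpha+m)/\Gamma(-\alpha)$ is read as the Pochhammer symbol $(-\alpha)_m=\prod_{j=0}^{m-1}(-\alpha+j)$ (which is also its limiting value when $\alpha$ is a nonnegative integer). *)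

(* Defs.v *)
From mathcomp Require Export all_boot all_order all_algebra.
From mathcomp Require Export complex.
From mathcomp Require Export all_classical all_reals all_analysis.

Set Implicit Arguments.
Unset Strict Implicit.
Unset Printing Implicit Defensive.

Import Order.TTheory GRing.Theory Num.Theory numFieldNormedType.Exports.
Local Open Scope classical_set_scope.
Local Open Scope ring_scope.
Local Open Scope complex_scope.

(* The complex numbers are R[i]; R[i]^o, i.e. R[i] seen as a normed module over
   itself, is the type that carries the topology given by the modulus. *)

Definition cexp (R : realType) (z : R[i]) : R[i]^o :=
  (expR (complex.Re z))%:C *
  (cos (complex.Im z) +i* sin (complex.Im z)).

(* x ^ z, with the principal (real) logarithm of x; meant for x > 0 *)
Definition cpow (R : realType) (x : R) (z : R[i]) : R[i]^o :=
  cexp (z * (ln x)%:C).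

Definition cintegrable (R : realType) (D : set R) (f : R -> R[i]^o) : Prop :=
  (@lebesgue_measure R).-integrable D (fun u => (complex.Re (f u))%:E) /\
  (@lebesgue_measure R).-integrable D (fun u => (complex.Im (f u))%:E).

Definition cintegral (R : realType) (D : set R) (f : R -> R[i]^o) : R[i]^o :=
  Rintegral (@lebesgue_measure R) D (fun u => complex.Re (f u)) +i*
  Rintegral (@lebesgue_measure R) D (fun u => complex.Im (f u)).

(* Euler's integral; meant for Re z > 0, the only case in which it is used *)
Definition cGamma (R : realType) (z : R[i]) : R[i]^o :=
  cintegral `]0, +oo[ (fun x => cpow x (z - 1) * (expR (- x))%:C).

Definition pochhammer (R : realType) (z : R[i]) (m : nat) : R[i]^o :=
  \prod_(j < m) (z + j%:R).

(* Derivatives of functions on [a, b] are one-sided at the endpoints. *)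
Definition diff_quot (R : realType) (f : R -> R[i]^o) (t s : R) : R[i]^o :=
  (f s - f t) / (s - t)%:C.

Definition derivable_on (R : realType) (a b : R) (f : R -> R[i]^o) (t : R) :
    Prop :=
  cvg (diff_quot f t s @[s --> within `[a, b] t^']).

Definition deriv_on (R : realType) (a b : R) (f : R -> R[i]^o) (t : R) :
    R[i]^o :=
  lim (diff_quot f t s @[s --> within `[a, b] t^']).

Definition Cn_on (R : realType) (n : nat) (a b : R) (f : R -> R[i]^o) : Prop :=
  (forall k t, (k < n)%N -> t \in `[a, b] ->
     derivable_on a b (iter k (deriv_on a b) f) t) /\
  (forall k, (k <= n)%N ->
     {within `[a, b], continuous (iter k (deriv_on a b) f)}).

(* floor (Re nu) + 1, meant for Re nu >= 0 *)
Definition frac_order (R : realType) (nu : R[i]) : nat :=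
  `|Num.floor (complex.Re nu)|%N.+1.

(* The defining integral of the Riemann-Liouville integral, for Re nu > 0 *)
Definition RL_integral_pos (R : realType) (a : R) (nu : R[i])
    (f : R -> R[i]^o) (t : R) : R[i]^o :=
  (cGamma nu)^-1 * cintegral `[a, t] (fun u => cpow (t - u) (nu - 1) * f u).

(* meant for Re nu >= 0 *)
Definition RL_derivative (R : realType) (a b : R) (nu : R[i])
    (f : R -> R[i]^o) : R -> R[i]^o :=
  let k := frac_order nu in
  iter k (deriv_on a b) (RL_integral_pos a (k%:R - nu) f).

Definition RL_integral (R : realType) (a b : R) (nu : R[i])
    (f : R -> R[i]^o) : R -> R[i]^o :=
  if 0 < complex.Re nu then RL_integral_pos a nu f
  else RL_derivative a b (- nu) f.

Definition T_integral (R : realType) (a : R) (alpha beta : R[i])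
    (f : R -> R[i]^o) (t : R) : R[i]^o :=
  (cGamma alpha)^-1 *
  cintegral `[a, t] (fun u =>
    cpow (t - u) (alpha - 1) * cexp (- (beta * (t - u)%:C)) * f u).

Definition T_derivative (R : realType) (a b : R) (alpha beta : R[i])
    (f : R -> R[i]^o) : R -> R[i]^o :=
  let n := frac_order alpha in
  iter n (fun g t => deriv_on a b g t + beta * g t)
    (T_integral a (n%:R - alpha) beta f).

(* Main.v *)
Require Import Defs.
From mathcomp Require Import measurable_realfun ring lra.
Set Implicit Arguments.
Unset Strict Implicit.
Unset Printing Implicit Defensive.
Import Order.TTheory GRing.Theory Num.Theory numFieldNormedType.Exports.
Local Open Scope classical_set_scope.
Local Open Scope ring_scope.
Local Open Scope complex_scope.

(** Let [conv a k f t] be the integral of [k (t - u) f u] over [a, t], and write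
    [I^s] for the Riemann-Liouville integral of order [s]. Up to a factor
    [1 / Gamma s], it is the convolution with [x ^ (s - 1)]; the tempered integral
    of order [s] is, up to the same factor, the convolution with
    [x ^ (s - 1) e ^ (- beta x)].

    Part (i). Expand the exponential in the kernel. The remainder of order [N]
    of the exponential series is at most [2 C ^ N x ^ N / N!] ([norm1_exp_rem]), so
    the error is bounded by a null sequence times the integral of
    [(t - u) ^ (Re alpha - 1) |f u|] ([conv_tempered_expansion]). By the Tonelli
    theorem this integral is finite for almost every [t] ([admissible_ae]). The
    constants agree because [Gamma (s + m) = (s)_m Gamma s], obtained from the
    functional equation of Gamma ([cGamma_rec]).

    Part (ii). Put [nu = n - alpha], so that [0 < Re nu <= 1], and let
    [L_j = I^(nu + j) f] for [j >= 0] and [L_(-j)] be the [j]-th derivative of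
    [L_0]. Part (i) at order [nu] writes the tempered integral as the sum of
    [(- beta) ^ m (nu)_m / m! L_m]. As [L_(j+1)' = L_j], applying [d/dt + beta]
    termwise turns a sum of [(- beta) ^ m (s)_m / m! L_(m-k)] into the sum of
    [(- beta) ^ m (s - 1)_m / m! L_(m-k-1)]: this is the identity
    [tempered_coefS]. After [n] steps [s = nu - n = - alpha], which is the
    announced series.

    Termwise differentiation of the infinite sum is avoided. After [k] steps,
    all terms with [m >= k] together are a multiple of the convolution of [f] with
    [tempered_kernel nu beta k], that is [x ^ (nu - k - 1)] times the remainder of
    order [k] of the exponential; so after each step there is a closed form, with
    finitely many terms and one convolution, and the series is expanded only at
    the end. One step on the closed form ([wderiv_conv_tempered]) consists in
    splitting off the singular part [x ^ (nu - 1)] of the kernel, whose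
    convolution is differentiated by [conv_wderiv],
      [(k * f)' (t) = k (t - a) f a + (k * f') (t)] for [t > a],
    and in differentiating the rest, which vanishes at the origin, on the side of
    the kernel ([conv_wderiv_kernel]).

    Derivatives in the theorem are one-sided at the endpoints and may be unbounded
    near [a], so every identity between functions is stated on ]a, b] only. *)

(** * Complex numbers through real and imaginary parts *)

(** A submultiplicative norm with real values, for explicit estimates. It costs
    constant factors with respect to the modulus, which never matter below. *)
Definition norm1 (R : realType) (z : R[i]) : R :=
  `|complex.Re z| + `|complex.Im z|.

Section ComplexBasics.
Variable R : realType.
Implicit Types z w : R[i].

Lemma norm1_ge0 z : 0 <= norm1 z.
Proof. by rewrite /norm1 addr_ge0. Qed.

Lemma norm1D z w : norm1 (z + w) <= norm1 z + norm1 w.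
Proof.
case: z w => [a b] [c d]; rewrite /norm1 /=.
by rewrite (addrACA `|a|) lerD // ler_normD.
Qed.

Lemma norm1N z : norm1 (- z) = norm1 z.
Proof. by case: z => a b; rewrite /norm1 /= !normrN. Qed.

Lemma norm1M z w : norm1 (z * w) <= norm1 z * norm1 w.
Proof.
case: z w => [a b] [c d]; rewrite /norm1 /=.
have h1 := ler_normB (a * c) (b * d); have h2 := ler_normD (a * d) (b * c).
apply: le_trans (lerD h1 h2) _; by rewrite !normrM; lra.
Qed.

Lemma norm1_real (x : R) : norm1 x%:C = `|x|.
Proof. by rewrite /norm1 /= normr0 addr0. Qed.

Lemma ler_Re_norm1 z : `|complex.Re z| <= norm1 z.
Proof. by rewrite /norm1 lerDl. Qed.

Lemma ler_Im_norm1 z : `|complex.Im z| <= norm1 z.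
Proof. by rewrite /norm1 lerDr. Qed.

Lemma ReD z w : complex.Re (z + w) = complex.Re z + complex.Re w.
Proof. by case: z w => [a b] [c d]. Qed.
Lemma ImD z w : complex.Im (z + w) = complex.Im z + complex.Im w.
Proof. by case: z w => [a b] [c d]. Qed.
Lemma ReN z : complex.Re (- z) = - complex.Re z.
Proof. by case: z. Qed.
Lemma ImN z : complex.Im (- z) = - complex.Im z.
Proof. by case: z. Qed.
Lemma ReM z w :
  complex.Re (z * w) = complex.Re z * complex.Re w - complex.Im z * complex.Im w.
Proof. by case: z w => [a b] [c d]. Qed.
Lemma ImM z w :
  complex.Im (z * w) = complex.Re z * complex.Im w + complex.Im z * complex.Re w.
Proof. by case: z w => [a b] [c d]. Qed.

Lemma complex_ext z w :
  complex.Re z = complex.Re w -> complex.Im z = complex.Im w -> z = w.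
Proof. by case: z w => [a b] [c d] /= -> ->. Qed.

Lemma Re_nat n : complex.Re (n%:R : R[i]) = n%:R.
Proof. by elim: n => [//|n IH]; rewrite -addn1 !natrD ReD IH. Qed.

(** The topology of [R[i]^o] comes from the modulus, itself an element of
    [R[i]]. From here on it is only used through real and imaginary parts, to
    which the real theorems (derivation, integration) apply. *)
Lemma cvg_complexP (T : Type) (F : set_system T) {FF : Filter F}
    (u : T -> R[i]^o) (l : R[i]^o) :
  (u x @[x --> F] --> l) <->
  ((fun x => complex.Re (u x)) x @[x --> F] --> complex.Re l /\
   (fun x => complex.Im (u x)) x @[x --> F] --> complex.Im l).
Proof.
have ReB z w : complex.Re (z - w) = complex.Re z - complex.Re w.
  by rewrite ReD ReN.
have ImB z w : complex.Im (z - w) = complex.Im z - complex.Im w.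
  by rewrite ImD ImN.
have le_norm1 z : `|z| <= (norm1 z)%:C.
  rewrite normc_def lecR -(ger0_norm (norm1_ge0 z)) -sqrtr_sqr ler_sqrt.
    rewrite /norm1 sqrrD !real_normK ?num_real // -addrA lerD2l lerDr.
    by rewrite mulrn_wge0 // mulr_ge0.
  by rewrite sqr_ge0.
have Im_le z : `|complex.Im z|%:C <= `|z|.
  rewrite normc_def lecR -sqrtr_sqr ler_sqrt ?addr_ge0 ?sqr_ge0 //.
  by rewrite lerDr sqr_ge0.
split=> [/cvgrPdist_lt h|[/cvgrPdist_lt h1 /cvgrPdist_lt h2]].
  split; apply/cvgrPdist_lt => e e0; have e0' : 0 < e%:C :> R[i] by rewrite ltcR.
    apply: filterS (h _ e0') => x hx.
    by rewrite -ltcR -ReB; apply: le_lt_trans hx; exact: normc_ge_Re.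
  apply: filterS (h _ e0') => x hx.
  by rewrite -ltcR -ImB; apply: le_lt_trans hx; exact: Im_le.
apply/cvgrPdist_lt => e.
rewrite ltcE /= => /andP[/eqP e_im e_re].
have e2 : 0 < complex.Re e / 2 by rewrite divr_gt0.
apply: filterS2 (h1 _ e2) (h2 _ e2) => x hx1 hx2.
apply: le_lt_trans (le_norm1 _) _.
rewrite ltcE /= -e_im eqxx /= /norm1 ReB ImB.
by rewrite [ltRHS]splitr ltrD.
Qed.

End ComplexBasics.

(** * Derivatives of complex-valued functions, exponential and powers *)

(** Componentwise, so that the derivation rules and the mean value theorem for
    real functions can be used. *)
Definition cderiv (R : realType) (h : R -> R[i]^o) (x : R) (d : R[i]) : Prop :=
  is_derive x (1 : R) (fun y => complex.Re (h y)) (complex.Re d) /\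
  is_derive x (1 : R) (fun y => complex.Im (h y)) (complex.Im d).

Section ComplexDerivative.
Variable R : realType.
Implicit Types (g h : R -> R[i]^o) (z d e : R[i]) (x y t : R).

Lemma is_derive_ext (f f' : R -> R) x (d d' : R) :
  is_derive x (1 : R) f d -> f =1 f' -> d = d' -> is_derive x (1 : R) f' d'.
Proof. by move=> h /funext <- <-. Qed.

Lemma cderiv_eq h x d d' : cderiv h x d -> d = d' -> cderiv h x d'.
Proof. by move=> ? <-. Qed.

Lemma cderiv_cst z x : cderiv (fun=> z) x 0.
Proof. by split; apply: is_derive_cst. Qed.

Lemma cderivD g h x d e :
  cderiv g x d -> cderiv h x e -> cderiv (fun y => g y + h y) x (d + e).
Proof.
move=> [g1 g2] [h1 h2]; split.
  by apply: (is_derive_ext (is_deriveD g1 h1)) => [y|]; rewrite ReD.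
by apply: (is_derive_ext (is_deriveD g2 h2)) => [y|]; rewrite ImD.
Qed.

Lemma cderivN h x e : cderiv h x e -> cderiv (fun y => - h y) x (- e).
Proof.
move=> [h1 h2]; split.
  by apply: (is_derive_ext (is_deriveN h1)) => [y|]; rewrite ReN.
by apply: (is_derive_ext (is_deriveN h2)) => [y|]; rewrite ImN.
Qed.

Lemma cderivM g h x d e :
  cderiv g x d -> cderiv h x e ->
  cderiv (fun y => g y * h y) x (d * h x + g x * e).
Proof.
move=> [g1 g2] [h1 h2]; split.
  apply: (is_derive_ext (is_deriveB (is_deriveM g1 h1) (is_deriveM g2 h2))).
    by move=> y; rewrite ReM.
  rewrite !(ReD, ReM) /GRing.scale /=; ring.
apply: (is_derive_ext (is_deriveD (is_deriveM g1 h2) (is_deriveM g2 h1))).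
  by move=> y; rewrite ImM.
rewrite !(ImD, ImM) /GRing.scale /=; ring.
Qed.

Lemma cderivZ z h x e : cderiv h x e -> cderiv (fun y => z * h y) x (z * e).
Proof.
move=> hx; apply: (cderiv_eq (cderivM (cderiv_cst z x) hx)).
by rewrite mul0r add0r.
Qed.

Lemma cderiv_real (phi : R -> R) x (e : R) :
  is_derive x (1 : R) phi e -> cderiv (fun y => (phi y)%:C) x e%:C.
Proof.
move=> h; split; first exact: (is_derive_ext h).
by apply: is_derive_cst.
Qed.

Lemma cderiv_comp (phi : R -> R) h x d (e : R) :
  cderiv h (phi x) d -> is_derive x (1 : R) phi e ->
  cderiv (fun y => h (phi y)) x (d * e%:C).
Proof.
move=> [h1 h2] p; split.
  apply: (is_derive_ext (is_derive1_comp h1 p)) => //.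
  by rewrite ReM /= mulr0 subr0.
apply: (is_derive_ext (is_derive1_comp h2 p)) => //.
by rewrite ImM /= mulr0 add0r.
Qed.

Lemma cderiv_cvg h x d : cderiv h x d -> h y @[y --> x] --> h x.
Proof.
move=> [[h1 _] [h2 _]]; apply/cvg_complexP; split.
  by apply: differentiable_continuous; apply/derivable1_diffP.
by apply: differentiable_continuous; apply/derivable1_diffP.
Qed.

Lemma cexpD z w : cexp (z + w) = cexp z * cexp w.
Proof.
case: z w => [a b] [c d]; apply: complex_ext.
  rewrite /cexp /= expRD cosD; simpc; rewrite /=; ring.
rewrite /cexp /= expRD sinD; simpc; rewrite /=; ring.
Qed.

Lemma cexp0 : cexp (0 : R[i]) = 1.
Proof.
apply: complex_ext; rewrite /cexp /= expR0 cos0 sin0 ?mul0r; simpc => //.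
Qed.

Lemma norm1_cexp z : norm1 (cexp z) <= 2 * expR (complex.Re z).
Proof.
rewrite /cexp; apply: le_trans (norm1M _ _) _.
rewrite norm1_real ger0_norm ?expR_ge0 // mulrC ler_wpM2r ?expR_ge0 //.
rewrite /norm1 /=.
have hc : `|cos (complex.Im z)| <= 1.
  by rewrite ler_norml cos_geN1 cos_le1.
have hs : `|sin (complex.Im z)| <= 1.
  by rewrite ler_norml sin_geN1 sin_le1.
lra.
Qed.

(** All the derivatives of exponentials and complex powers below come from this
    case, with [phi] the identity or the logarithm. *)
Lemma cderiv_cexp z (phi : R -> R) x (e : R) :
  is_derive x (1 : R) phi e ->
  cderiv (fun y => cexp (z * (phi y)%:C)) x (z * e%:C * cexp (z * (phi x)%:C)).
Proof.
move=> p; case: z => a b.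
have E y : cexp ((a +i* b) * (phi y)%:C) =
   (expR (a * phi y))%:C * (cos (b * phi y) +i* sin (b * phi y)).
  by rewrite /cexp; simpc.
have pa : is_derive x 1 (fun y => a * phi y) (a * e).
  exact: (is_derive_ext (is_deriveZ a p)).
have pb : is_derive x 1 (fun y => b * phi y) (b * e).
  exact: (is_derive_ext (is_deriveZ b p)).
have p1 := @is_derive1_comp R expR (fun y => a * phi y) x _ _
  (is_derive_expR (a * phi x)) pa.
have p2 := @is_derive1_comp R cos (fun y => b * phi y) x _ _
  (is_derive_cos (b * phi x)) pb.
have p3 := @is_derive1_comp R sin (fun y => b * phi y) x _ _
  (is_derive_sin (b * phi x)) pb.
have p4 : cderiv (fun y => cos (b * phi y) +i* sin (b * phi y)) x
   ((- sin (b * phi x) * (b * e)) +i* (cos (b * phi x) * (b * e))).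
  by split.
have := cderivM (cderiv_real p1) p4.
rewrite (_ : (fun y => _) = (fun y => cexp ((a +i* b) * (phi y)%:C))); last first.
  by apply/funext => y; rewrite E.
move=> h; apply: (cderiv_eq h); rewrite E; simpc.
by apply: complex_ext => /=; ring.
Qed.

Lemma cpowD x z w : cpow x (z + w) = cpow x z * cpow x w.
Proof. by rewrite /cpow mulrDl cexpD. Qed.

Lemma cpow_nat x n : 0 < x -> cpow x n%:R = (x ^+ n)%:C.
Proof.
move=> x0; elim: n => [|n IH]; first by rewrite /cpow mul0r cexp0.
rewrite -addn1 natrD cpowD IH exprD expr1 rmorphM /=; congr (_ * _).
rewrite /cpow mul1r; apply: complex_ext; rewrite /cexp /= lnK ?posrE //.
  by rewrite cos0 sin0; simpc.
by rewrite cos0 sin0; simpc.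
Qed.

Lemma cpow1 x : 0 < x -> cpow x 1 = x%:C.
Proof. by move=> x0; rewrite (cpow_nat 1). Qed.

Lemma norm1_cpow x z : 0 < x -> norm1 (cpow x z) <= 2 * x `^ complex.Re z.
Proof.
move=> x0; apply: le_trans (norm1_cexp _) _.
by rewrite ReM /= mulr0 subr0 /powR gt_eqF.
Qed.

Lemma cderiv_cpow x z : 0 < x ->
  cderiv (fun y => cpow y z) x (z * cpow x (z - 1)).
Proof.
move=> x0; apply: (cderiv_eq (cderiv_cexp z (is_derive1_ln x0))).
have xC : x%:C * x^-1%:C = 1 :> R[i] by rewrite -rmorphM /= divff ?gt_eqF.
rewrite -[in LHS](subrK 1 z) [in X in _ * X](_ : cexp _ = cpow x (z - 1) * x%:C).
  rewrite subrK; transitivity (z * cpow x (z - 1) * (x%:C * x^-1%:C)).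
    by ring.
  by rewrite xC mulr1.
by rewrite -(cpow1 x0) -cpowD.
Qed.

End ComplexDerivative.

(** * Integrals of complex-valued functions *)

Section RealIntegrals.
Variable R : realType.
Local Notation mu := (@lebesgue_measure R).
Implicit Types (D : set R) (f F G : R -> R).

Lemma dominated_integrable D f G : measurable D -> measurable_fun D f ->
  mu.-integrable D (EFin \o G) -> (forall x, D x -> `|f x| <= G x) ->
  mu.-integrable D (fun x => (f x)%:E).
Proof.
move=> mD mf iG leG.
apply: (@le_integrable _ _ _ mu D mD _ (EFin \o G)) => //.
  by apply/measurable_EFinP; exact: mf.
move=> x Dx; rewrite /= lee_fin; apply: le_trans (ler_norm _).
exact: leG.
Qed.

Lemma integrable_ext D f G : measurable D -> (forall x, D x -> f x = G x) ->
  mu.-integrable D (fun x => (f x)%:E) -> mu.-integrable D (fun x => (G x)%:E).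
Proof.
move=> mD fG; apply: (@eq_integrable _ _ _ mu D mD) => x.
by rewrite inE => /fG ->.
Qed.

Lemma integrable_add D f G : measurable D ->
  mu.-integrable D (fun x => (f x)%:E) -> mu.-integrable D (fun x => (G x)%:E) ->
  mu.-integrable D (fun x => (f x + G x)%:E).
Proof.
move=> mD hf hG.
exact: (@integrableD _ _ _ mu D mD (EFin \o f) (EFin \o G)).
Qed.

Lemma integrable_scale D f (r : R) : measurable D ->
  mu.-integrable D (fun x => (f x)%:E) ->
  mu.-integrable D (fun x => (r * f x)%:E).
Proof. by move=> mD hf; exact: (@integrableZl _ _ _ mu D mD r (EFin \o f)). Qed.

Lemma le_norm_Rintegral D f G : measurable D ->
  mu.-integrable D (fun x => (f x)%:E) -> mu.-integrable D (fun x => (G x)%:E) ->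
  (forall x, D x -> `|f x| <= G x) ->
  `|Rintegral mu D f| <= Rintegral mu D G.
Proof.
move=> mD hf hG fG; apply: le_trans (@le_normr_Rintegral _ _ _ mu D f mD hf) _.
apply: (@le_Rintegral _ _ _ mu D) => //.
exact: (@integrable_norm _ _ _ mu D f hf).
Qed.

Lemma Rintegral_cvg_dominated D (f_ : nat -> R -> R) f G :
  measurable D -> (forall n, measurable_fun D (f_ n)) ->
  (forall x, D x -> f_ n x @[n --> \oo] --> f x) ->
  mu.-integrable D (EFin \o G) ->
  (forall n x, D x -> `|f_ n x| <= G x) ->
  mu.-integrable D (EFin \o f) /\
  Rintegral mu D (f_ n) @[n --> \oo] --> Rintegral mu D f.
Proof.
move=> mD mf_ cf iG leG.
have mf : measurable_fun D f := measurable_fun_cvg mf_ cf.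
have [] := @dominated_convergence _ _ _ mu D mD
  (fun n => EFin \o f_ n) (EFin \o f) (EFin \o G) _ _ _ iG _.
- by move=> n; apply/measurable_EFinP; exact: mf_.
- exact/measurable_EFinP.
- by apply: aeW => x Dx; apply: cvg_EFin; [exact: nearW|exact: cf].
- by apply: aeW => x n Dx; rewrite /= lee_fin leG.
move=> intf _ cv; split => //.
apply: fine_cvg; rewrite fineK; first exact: cv.
exact: integrable_fin_num.
Qed.

(** Improper form of the fundamental theorem of calculus: it holds on every
    segment [[x_ n, y_ n]], and the integrals over these segments converge to the
    integral over [D] by domination by [|f|]. The derivative may be unbounded
    near the ends of [D], and [D] may be a half-line. *)
Lemma Rintegral_exhaustion D F f (x_ y_ : nat -> R) (L : R) :
  measurable D -> (forall n, x_ n < y_ n) ->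
  (forall n, `[x_ n, y_ n] `<=` D) ->
  (forall z, D z -> \forall n \near \oo, z \in `[x_ n, y_ n]) ->
  (forall z, D z -> is_derive z (1 : R) F (f z)) ->
  (forall z, D z -> {for z, continuous f}) ->
  mu.-integrable D (EFin \o f) ->
  F (y_ n) - F (x_ n) @[n --> \oo] --> L ->
  Rintegral mu D f = L.
Proof.
move=> mD xy xyD exh dF cf intf cvL.
have mf : measurable_fun D f by apply/measurable_EFinP; exact: measurable_int intf.
have FTC n : Rintegral mu `[x_ n, y_ n] f = F (y_ n) - F (x_ n).
  rewrite /Rintegral (@continuous_FTC2 _ f F) //.
  - apply: continuous_in_subspaceT => z; rewrite inE => zxy.
    exact/cf/(xyD n).
  - have cF z : z \in `[x_ n, y_ n] -> F w @[w --> z] --> F z.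
      move=> zxy; have [dz _] := dF z (xyD n _ zxy).
      by apply: differentiable_continuous; apply/derivable1_diffP.
    split.
    + move=> z zxy; have [] := dF z _ => //; apply: (xyD n).
      exact: subset_itv_oo_cc.
    + by apply: cvg_at_right_filter; apply: cF; rewrite bound_itvE ltW.
    + by apply: cvg_at_left_filter; apply: cF; rewrite bound_itvE ltW.
  - move=> z zxy; rewrite derive1E; have [|_ //] := dF z; apply: (xyD n).
    exact: subset_itv_oo_cc.
pose f_ n := f \_ `[x_ n, y_ n].
have [||||_ cv] := @Rintegral_cvg_dominated D f_ f (fun x => `|f x|) mD.
- move=> n; apply/(measurable_restrict _ _ mD) => //.
  by apply: measurable_funS mf => //; apply: subIsetl.
- move=> x Dx; apply: cvg_near_cst; near=> n.
  rewrite /f_ patchE mem_set //=; near: n; exact: exh.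
- exact: (integrable_norm intf).
- move=> n x Dx; rewrite /f_ patchE; case: ifP => // _.
  by rewrite normr0.
apply: (cvg_unique _ cv) => //=.
suff -> : (fun n => Rintegral mu D (f_ n)) = (fun n => F (y_ n) - F (x_ n)) by [].
apply/funext => n; rewrite -FTC /Rintegral /f_; congr fine.
rewrite -[in RHS](setIidr (xyD n)) integral_mkcondr.
by apply: eq_integral => z _; rewrite /= !patchE; case: ifP.
Unshelve. all: by end_near. Qed.

End RealIntegrals.

Definition cmeasurable (R : realType) (D : set R) (g : R -> R[i]^o) : Prop :=
  measurable_fun D (fun x => complex.Re (g x)) /\
  measurable_fun D (fun x => complex.Im (g x)).

Section ComplexIntegrals.
Variable R : realType.
Local Notation mu := (@lebesgue_measure R).
Implicit Types (D : set R) (g h : R -> R[i]^o) (z : R[i]) (G : R -> R).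

Lemma cmeasurable_cst D z : cmeasurable D (fun=> z).
Proof. by split; apply: measurable_cst. Qed.

Lemma cmeasurableD D g h : cmeasurable D g -> cmeasurable D h ->
  cmeasurable D (fun x => g x + h x).
Proof.
move=> [g1 g2] [h1 h2]; split.
  by under eq_fun do rewrite ReD; apply: measurable_funD.
by under eq_fun do rewrite ImD; apply: measurable_funD.
Qed.

Lemma cmeasurableM D g h : cmeasurable D g -> cmeasurable D h ->
  cmeasurable D (fun x => g x * h x).
Proof.
move=> [g1 g2] [h1 h2]; split.
  by under eq_fun do rewrite ReM; apply: measurable_funB; apply: measurable_funM.
by under eq_fun do rewrite ImM; apply: measurable_funD; apply: measurable_funM.
Qed.

Lemma cmeasurableZ D z g : cmeasurable D g -> cmeasurable D (fun x => z * g x).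
Proof. by move=> mg; apply: cmeasurableM => //; apply: cmeasurable_cst. Qed.

Lemma cmeasurableS D D' g : measurable D -> D' `<=` D ->
  cmeasurable D g -> cmeasurable D' g.
Proof. by move=> mD sD [g1 g2]; split; apply: measurable_funS; eauto. Qed.

Lemma cmeasurable_norm1 D g : cmeasurable D g ->
  measurable_fun D (fun x => norm1 (g x)).
Proof.
move=> [g1 g2]; apply: measurable_funD; exact: measurableT_comp.
Qed.

Lemma open_cmeasurable D g : open D ->
  (forall x, D x -> g y @[y --> x] --> g x) -> cmeasurable D g.
Proof.
move=> oD cg; split; apply: open_continuous_measurable_fun => // x.
  by rewrite inE => /cg /cvg_complexP[].
by rewrite inE => /cg /cvg_complexP[].
Qed.

Lemma dominated_cintegrable D g G : measurable D -> cmeasurable D g ->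
  mu.-integrable D (EFin \o G) -> (forall x, D x -> norm1 (g x) <= G x) ->
  cintegrable D g.
Proof.
move=> mD [g1 g2] iG leG; split; apply: (dominated_integrable mD _ iG) => // x Dx.
  exact: le_trans (ler_Re_norm1 _) (leG _ Dx).
exact: le_trans (ler_Im_norm1 _) (leG _ Dx).
Qed.

Lemma cintegrable_norm1 D g : measurable D -> cintegrable D g ->
  mu.-integrable D (fun x => (norm1 (g x))%:E).
Proof.
move=> mD [g1 g2].
have h1 := integrable_norm g1; have h2 := integrable_norm g2.
exact: integrable_add mD h1 h2.
Qed.

Lemma cintegrable_measurable D g : cintegrable D g -> cmeasurable D g.
Proof.
by move=> [g1 g2]; split; apply/measurable_EFinP;
  [exact: measurable_int g1|exact: measurable_int g2].
Qed.

Lemma cintegrableS D D' g : measurable D -> measurable D' -> D' `<=` D ->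
  cintegrable D g -> cintegrable D' g.
Proof. by move=> mD mD' sD [g1 g2]; split; apply: (@integrableS _ _ _ mu D D'). Qed.

Lemma eq_cintegrable D g h : measurable D -> {in D, g =1 h} ->
  cintegrable D g -> cintegrable D h.
Proof.
move=> mD gh [g1 g2]; split.
  by apply: integrable_ext g1 => // x Dx; rewrite gh ?inE.
by apply: integrable_ext g2 => // x Dx; rewrite gh ?inE.
Qed.

Lemma eq_cintegral D g h : {in D, g =1 h} -> cintegral D g = cintegral D h.
Proof.
by move=> gh; congr (_ +i* _); apply: eq_Rintegral => x /gh ->.
Qed.

Lemma cintegrableD D g h : measurable D ->
  cintegrable D g -> cintegrable D h -> cintegrable D (fun x => g x + h x).
Proof.
move=> mD [g1 g2] [h1 h2]; split.
  by apply: integrable_ext (integrable_add mD g1 h1) => // x _; rewrite ReD.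
by apply: integrable_ext (integrable_add mD g2 h2) => // x _; rewrite ImD.
Qed.

Lemma cintegralD D g h : measurable D ->
  cintegrable D g -> cintegrable D h ->
  cintegral D (fun x => g x + h x) = cintegral D g + cintegral D h.
Proof.
move=> mD [g1 g2] [h1 h2]; rewrite /cintegral; apply: complex_ext.
  rewrite ReD /= -RintegralD //.
  by apply: eq_Rintegral => x _; rewrite ReD.
rewrite ImD /= -RintegralD //.
by apply: eq_Rintegral => x _; rewrite ImD.
Qed.

Lemma cintegrableZ D z g : measurable D ->
  cintegrable D g -> cintegrable D (fun x => z * g x).
Proof.
move=> mD ig.
apply: (@dominated_cintegrable _ _ (fun x => norm1 z * norm1 (g x))) => //.
- exact/cmeasurableZ/cintegrable_measurable.
- exact: integrable_scale (norm1 z) mD (cintegrable_norm1 mD ig).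
- by move=> x _; apply: norm1M.
Qed.

Lemma cintegralZ D z g : measurable D -> cintegrable D g ->
  cintegral D (fun x => z * g x) = z * cintegral D g.
Proof.
move=> mD [g1 g2]; rewrite /cintegral; apply: complex_ext.
  rewrite ReM /= -!RintegralZl // -RintegralB //;
    [|exact: integrable_scale mD g1|exact: integrable_scale mD g2].
  by apply: eq_Rintegral => x _; rewrite ReM.
rewrite ImM /= -!RintegralZl // -RintegralD //;
  [|exact: integrable_scale mD g2|exact: integrable_scale mD g1].
by apply: eq_Rintegral => x _; rewrite ImM.
Qed.

Lemma norm1_cintegral_le D g G : measurable D -> cmeasurable D g ->
  mu.-integrable D (EFin \o G) -> (forall x, D x -> norm1 (g x) <= G x) ->
  norm1 (cintegral D g) <= 2 * Rintegral mu D G.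
Proof.
move=> mD mg iG leG; have [g1 g2] := dominated_cintegrable mD mg iG leG.
rewrite /norm1 /= (_ : 2 * _ = Rintegral mu D G + Rintegral mu D G); last by ring.
apply: lerD.
  apply: (le_norm_Rintegral mD g1) => // x Dx.
  by apply: le_trans (leG _ Dx); apply: ler_Re_norm1.
apply: (le_norm_Rintegral mD g2) => // x Dx.
by apply: le_trans (leG _ Dx); apply: ler_Im_norm1.
Qed.

Lemma cintegral_cvg_dominated D (g_ : nat -> R -> R[i]^o) g G :
  measurable D -> (forall n, cmeasurable D (g_ n)) ->
  (forall x, D x -> g_ n x @[n --> \oo] --> g x) ->
  mu.-integrable D (EFin \o G) ->
  (forall n x, D x -> norm1 (g_ n x) <= G x) ->
  cintegral D (g_ n) @[n --> \oo] --> cintegral D g.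
Proof.
move=> mD mg cg iG leG; apply/cvg_complexP; split.
  apply: (Rintegral_cvg_dominated mD _ _ iG _).2 => [n|x Dx|n x Dx].
  - by have [] := mg n.
  - by have /cvg_complexP[] := cg x Dx.
  - exact: le_trans (ler_Re_norm1 _) (leG n x Dx).
apply: (Rintegral_cvg_dominated mD _ _ iG _).2 => [n|x Dx|n x Dx].
- by have [] := mg n.
- by have /cvg_complexP[] := cg x Dx.
- exact: le_trans (ler_Im_norm1 _) (leG n x Dx).
Qed.

Lemma cintegral_exhaustion D (F f : R -> R[i]^o) (x_ y_ : nat -> R) (L : R[i]^o) :
  measurable D -> (forall n, x_ n < y_ n) ->
  (forall n, `[x_ n, y_ n] `<=` D) ->
  (forall x : R, D x -> \forall n \near \oo, x \in `[x_ n, y_ n]) ->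
  (forall x : R, D x -> cderiv F x (f x)) ->
  (forall x : R, D x -> f w @[w --> x] --> f x) ->
  cintegrable D f ->
  F (y_ n) - F (x_ n) @[n --> \oo] --> L ->
  cintegral D f = L.
Proof.
move=> mD xy xyD exh dF cf [if1 if2] /cvg_complexP[c1 c2].
apply: complex_ext => /=.
apply: (@Rintegral_exhaustion _ D (fun x => complex.Re (F x))
    (fun x => complex.Re (f x)) x_ y_ _ mD xy xyD exh _ _ if1 _).
- by move=> x /dF[].
- by move=> x /cf /cvg_complexP[].
- rewrite (_ : (fun n => _) = (fun n => complex.Re (F (y_ n) - F (x_ n)))) //.
  by apply/funext => n; rewrite ReD ReN.
apply: (@Rintegral_exhaustion _ D (fun x => complex.Im (F x))
    (fun x => complex.Im (f x)) x_ y_ _ mD xy xyD exh _ _ if2 _).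
- by move=> x /dF[].
- by move=> x /cf /cvg_complexP[].
- rewrite (_ : (fun n => _) = (fun n => complex.Im (F (y_ n) - F (x_ n)))) //.
  by apply/funext => n; rewrite ImD ImN.
Qed.

End ComplexIntegrals.

(** * Limits of complex-valued functions and an integrable majorant *)

Lemma is_derive_cvg (R : realType) (f : R -> R) (x d : R) :
  is_derive x (1 : R) f d -> {for x, continuous f}.
Proof.
move=> [h _]; apply: differentiable_continuous; exact/derivable1_diffP.
Qed.

Lemma norm1_squeeze (R : realType) (T : Type) (F : set_system T)
    {FF : Filter F} (u : T -> R[i]^o) (l : R[i]^o) (e : T -> R) :
  (\forall x \near F, norm1 (l - u x) <= e x) ->
  e x @[x --> F] --> 0 -> u x @[x --> F] --> l.
Proof.
move=> le_e /cvgrPdist_lt e0; apply/cvg_complexP; split;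
  apply/cvgrPdist_lt => eps eps0; near=> x.
  have h : norm1 (l - u x) <= e x by near: x.
  have : `|0 - e x| < eps by near: x; exact: e0.
  rewrite sub0r normrN => /(le_lt_trans (ler_norm _)); apply: le_lt_trans.
  by rewrite -ReN -ReD; apply: le_trans h; apply: ler_Re_norm1.
have h : norm1 (l - u x) <= e x by near: x.
have : `|0 - e x| < eps by near: x; exact: e0.
rewrite sub0r normrN => /(le_lt_trans (ler_norm _)); apply: le_lt_trans.
by rewrite -ImN -ImD; apply: le_trans h; apply: ler_Im_norm1.
Unshelve. all: by end_near. Qed.

Lemma cvg_complexD (R : realType) (T : Type) (F : set_system T)
    {FF : Filter F} (u v : T -> R[i]^o) (l m : R[i]^o) :
  u x @[x --> F] --> l -> v x @[x --> F] --> m ->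
  u x + v x @[x --> F] --> (l + m : R[i]^o).
Proof.
move=> /cvg_complexP[u1 u2] /cvg_complexP[v1 v2]; apply/cvg_complexP; split.
  rewrite ReD (_ : (fun x => _) = fun x => complex.Re (u x) + complex.Re (v x)).
    exact: (cvgD u1 v1).
  by apply/funext => x; rewrite ReD.
rewrite ImD (_ : (fun x => _) = fun x => complex.Im (u x) + complex.Im (v x)).
  exact: (cvgD u2 v2).
by apply/funext => x; rewrite ImD.
Qed.

Lemma cvg_complexM (R : realType) (T : Type) (F : set_system T)
    {FF : Filter F} (u v : T -> R[i]^o) (l m : R[i]^o) :
  u x @[x --> F] --> l -> v x @[x --> F] --> m ->
  u x * v x @[x --> F] --> (l * m : R[i]^o).
Proof.
move=> /cvg_complexP[u1 u2] /cvg_complexP[v1 v2]; apply/cvg_complexP; split.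
  rewrite ReM (_ : (fun x => _) = fun x => complex.Re (u x) * complex.Re (v x) -
    complex.Im (u x) * complex.Im (v x)); last by apply/funext => x; rewrite ReM.
  exact: (cvgB (cvgM u1 v1) (cvgM u2 v2)).
rewrite ImM (_ : (fun x => _) = fun x => complex.Re (u x) * complex.Im (v x) +
  complex.Im (u x) * complex.Re (v x)); last by apply/funext => x; rewrite ImM.
exact: (cvgD (cvgM u1 v2) (cvgM u2 v1)).
Qed.

Lemma cvg_complexZ (R : realType) (T : Type) (F : set_system T)
    {FF : Filter F} (z : R[i]) (u : T -> R[i]^o) (l : R[i]^o) :
  u x @[x --> F] --> l -> z * u x @[x --> F] --> (z * l : R[i]^o).
Proof.
move=> hu.
exact: (@cvg_complexM _ _ _ FF (fun=> z) u z l (cvg_cst (z : R[i]^o)) hu).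
Qed.

Section Majorants.
Variable R : realType.
Local Notation mu := (@lebesgue_measure R).
Implicit Types (x r : R).

(** Up to constants, this function dominates [x ^ (r - 1)] on bounded intervals
    and [x ^ (r - 1) e ^ (- x)] on the half-line; its primitive
    [(x / (1 + x)) ^ r / r] is explicit and bounded, so one computation gives the
    integrability of both. *)
Definition beta_kernel r x : R := x `^ (r - 1) * (1 + x) `^ (- r - 1).

Lemma is_derive_powR1D (s x : R) : 0 < x ->
  is_derive x (1 : R) (fun y => (1 + y) `^ s) (s * (1 + x) `^ (s - 1)).
Proof.
move=> x0; have x1 : 0 < 1 + x by rewrite addr_gt0.
have p : is_derive x (1 : R) (fun y : R => 1 + y) 1.
  by apply: (is_derive_ext (@is_derive_shift R x 1 1)) => // y; rewrite /= addrC.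
apply: (is_derive_ext (@is_derive1_comp R (fun y => y `^ s) (fun y => 1 + y)
  x _ _ (is_derive1_powR s x1) p)) => //.
by rewrite mulr1.
Qed.

Lemma beta_kernel_continuous r x : 0 < x ->
  {for x, continuous (beta_kernel r)}.
Proof.
move=> x0; apply: is_derive_cvg.
exact: (is_deriveM (is_derive1_powR (r - 1) x0) (is_derive_powR1D (- r - 1) x0)).
Qed.

Lemma is_derive_beta_primitive r x : 0 < r -> 0 < x ->
  is_derive x (1 : R) (fun y => r^-1 * (y `^ r * (1 + y) `^ (- r)))
    (beta_kernel r x).
Proof.
move=> r0 x0; have x1 : 0 < 1 + x by rewrite addr_gt0.
have h := is_deriveM (is_derive1_powR r x0) (is_derive_powR1D (- r) x0).
apply: (is_derive_ext (is_deriveZ r^-1 h)) => //.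
rewrite /GRing.scale /= /beta_kernel.
rewrite -{1}(mulr_powRB1 (ltW x0) r0).
have -> : (1 + x) `^ (- r) = (1 + x) * (1 + x) `^ (- r - 1).
  rewrite -[X in X * _](powRr1 (ltW x1)) -powRD; last first.
    by rewrite (gt_eqF x1) implybT.
  by congr (_ `^ _); ring.
by field; rewrite gt_eqF.
Qed.

(** The segments [[1 / (n + 1), n + 2]] exhaust the half-line; the shift in the
    right end makes them nondegenerate for every [n]. *)
Lemma exhaust_gt0 x : 0 < x ->
  \forall n \near \oo, x \in `[(n.+1%:R : R)^-1, n.+2%:R].
Proof.
move=> x0; near=> n; rewrite in_itv /=; apply/andP; split.
  rewrite invf_ple ?posrE ?ltr0n //.
  apply: (@le_trans _ _ n%:R); last by rewrite ler_nat.
  by near: n; apply: nbhs_infty_ger.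
apply: (@le_trans _ _ n%:R); last by rewrite ler_nat leqW.
by near: n; apply: nbhs_infty_ger.
Unshelve. all: by end_near. Qed.

Lemma exhaust_lt n : (n.+1%:R : R)^-1 < n.+2%:R.
Proof.
apply: (@le_lt_trans _ _ 1); first by rewrite invf_le1 ?ltr0n // ler1n.
by rewrite ltr1n.
Qed.

Lemma exhaust_sub n : `[(n.+1%:R : R)^-1, n.+2%:R] `<=` `]0, +oo[%classic.
Proof.
move=> x /=; rewrite !in_itv /= andbT => /andP[h _].
by apply: lt_le_trans h; rewrite invr_gt0 ltr0n.
Qed.

(** Monotone convergence along the exhaustion; the integral over each segment is
    bounded by the supremum [1 / r] of the primitive. *)
Lemma integrable_beta_kernel r : 0 < r ->
  mu.-integrable `]0, +oo[ (fun x => (beta_kernel r x)%:E).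
Proof.
move=> r0; pose D := `]0, +oo[%classic : set R.
have mD : measurable D by exact: measurable_itv.
pose F x := r^-1 * (x `^ r * (1 + x) `^ (- r)).
have k0 x : 0 <= beta_kernel r x by rewrite mulr_ge0 ?powR_ge0.
have mk : measurable_fun D (beta_kernel r).
  apply: open_continuous_measurable_fun => // x.
  rewrite inE /D /= in_itv /= andbT => x0; exact: beta_kernel_continuous.
have FTC n : (\int[mu]_(x in `[((n.+1%:R : R)^-1)%R, n.+2%:R%R]) (beta_kernel r x)%:E
    <= (r^-1)%:E)%E.
  rewrite (@continuous_FTC2 _ (beta_kernel r) F) ?exhaust_lt //.
  - rewrite -EFinB lee_fin; apply: (@le_trans _ _ (F n.+2%:R)).
      by rewrite lerBlDr lerDl /F !mulr_ge0 ?invr_ge0 ?powR_ge0 ?(ltW r0).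
    have : 0 < n.+2%:R :> R by rewrite ltr0n.
    move: n.+2%:R => y y0; have y1 : 0 < 1 + y by rewrite addr_gt0.
    rewrite /F -[leRHS]mulr1; apply: ler_wpM2l; first by rewrite invr_ge0 ltW.
    rewrite powRN ler_pdivrMr ?powR_gt0 // mul1r.
    by apply: ge0_ler_powR; rewrite ?nnegrE ?(ltW r0) ?(ltW y0) ?(ltW y1) ?lerDr.
  - apply: continuous_in_subspaceT => x; rewrite inE => /exhaust_sub /=.
    by rewrite in_itv /= andbT => x0; exact: beta_kernel_continuous.
  - have dF x : x \in `[(n.+1%:R : R)^-1, n.+2%:R] ->
        is_derive x (1 : R) F (beta_kernel r x).
      move=> /exhaust_sub /=; rewrite in_itv /= andbT => x0.
      exact: is_derive_beta_primitive.
    split.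
    + by move=> x xn; have [] := dF x (subset_itv_oo_cc xn).
    + apply: cvg_at_right_filter; apply: is_derive_cvg (dF _ _).
      by rewrite bound_itvE ltW ?exhaust_lt.
    + apply: cvg_at_left_filter; apply: is_derive_cvg (dF _ _).
      by rewrite bound_itvE ltW ?exhaust_lt.
  - move=> x /subset_itv_oo_cc /exhaust_sub /=; rewrite in_itv /= andbT => x0.
    by rewrite derive1E; have [_ ->] := is_derive_beta_primitive r0 x0.
have UD : \bigcup_n `[(n.+1%:R : R)^-1, n.+2%:R]%classic = D.
  apply/seteqP; split => [x [n _ /exhaust_sub]//|x].
  rewrite /D /= in_itv /= andbT => /exhaust_gt0 [n _ /(_ n (leqnn n)) h].
  by exists n.
apply/integrableP; split; first by apply/measurable_EFinP; exact: mk.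
under eq_integral do rewrite gee0_abs ?lee_fin //.
rewrite -[X in integral _ X]/D -UD.
apply: (@le_lt_trans _ _ (r^-1)%:E); last exact: ltry.
have cv : (\int[mu]_(x in `[((n.+1%:R : R)^-1)%R, n.+2%:R%R])
      (beta_kernel r x)%:E)%E @[n --> \oo] -->
    (\int[mu]_(x in \bigcup_n `[((n.+1%:R : R)^-1)%R, n.+2%:R%R]%classic)
      (beta_kernel r x)%:E)%E.
  apply: (@ge0_nondecreasing_set_cvg_integral _ (measurableTypeR R) R
    (fun n => `[(n.+1%:R : R)^-1, n.+2%:R]%classic)).
  - move=> m n mn; apply/subsetPset => x /=; rewrite !in_itv /= => /andP[h1 h2].
    apply/andP; split.
      by apply: le_trans h1; rewrite lef_pV2 ?posrE ?ltr0n // ler_nat ltnS.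
    by apply: le_trans h2 _; rewrite ler_nat !ltnS.
  - by move=> n; exact: measurable_itv.
  - move=> n; apply/measurable_EFinP; apply: measurable_funS mk => //.
    exact: exhaust_sub.
  - by move=> n x _; rewrite lee_fin.
rewrite -(cvg_lim _ cv) //.
apply: lime_le; last by apply: nearW => n; exact: FTC.
by apply/cvg_ex; eexists; exact: cv.
Qed.

End Majorants.

(** * The functional equation of the Gamma function *)

Section Gamma.
Variable R : realType.
Local Notation mu := (@lebesgue_measure R).
Implicit Types (x r : R) (z : R[i]).

Lemma le_powR_beta_kernel r (L x : R) : 0 < r -> 0 < x -> x <= L ->
  x `^ (r - 1) <= (1 + L) `^ (r + 1) * beta_kernel r x.
Proof.
move=> r0 x0 xL; rewrite /beta_kernel mulrCA ler_peMr ?powR_ge0 //.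
have x1 : 0 < 1 + x by rewrite addr_gt0.
rewrite -opprD powRN ler_pdivlMr ?powR_gt0 // mul1r.
apply: ge0_ler_powR; rewrite ?nnegrE; lra.
Qed.

Lemma integrable_powR r (L : R) : 0 < r ->
  mu.-integrable `]0, L] (fun x => (x `^ (r - 1))%:E).
Proof.
move=> r0; have mI : measurable (`]0, L]%classic : set R) by exact: measurable_itv.
have sI : `]0, L] `<=` `]0, +oo[%classic.
  by move=> x /=; rewrite !in_itv /= => /andP[-> _].
apply: (@dominated_integrable R _ _ (fun x => (1 + L) `^ (r + 1) * beta_kernel r x)) => //.
- by apply: measurable_funTS; exact: measurable_powR.
- apply: integrable_scale => //.
  apply: (@integrableS _ _ _ mu `]0, +oo[ `]0, L]) => //.
  exact: integrable_beta_kernel.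
- move=> x /=; rewrite in_itv /= => /andP[x0 xL].
  by rewrite ger0_norm ?powR_ge0 // le_powR_beta_kernel.
Qed.

(** The claim is that [(1 + x) ^ (r + 1) e ^ (- x)] is bounded: compare with the
    term of order [n + 1] of the series of [e ^ (1 + x)], where [n > r]. *)
Lemma le_powR_expR r : 0 < r -> exists2 C, 0 <= C & forall x, 0 < x ->
  x `^ (r - 1) * expR (- x) <= C * beta_kernel r x.
Proof.
move=> r0; pose n := Num.bound r.
have rn : r < n%:R.
  by have := archi_boundP (ltW r0); rewrite /n.
exists ((n.+1)`!%:R * expR 1); first by rewrite mulr_ge0 ?expR_ge0.
move=> x x0; have x1 : 0 < 1 + x by rewrite addr_gt0.
rewrite /beta_kernel mulrCA ler_wpM2l ?powR_ge0 //.
rewrite -opprD powRN ler_pdivlMr ?powR_gt0 //.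
rewrite expRN mulrC ler_pdivrMr ?expR_gt0 // -mulrA -expRD.
apply: (@le_trans _ _ ((1 + x) ^+ n.+1)).
  rewrite -powR_mulrn ?(ltW x1) //; apply: ler_powR; first by rewrite lerDl ltW.
  by rewrite -natr1; lra.
rewrite mulrC -ler_pdivrMr ?ltr0n ?fact_gt0 //.
apply: le_trans (expR_ge1Dxn n (ltW x1)).
by rewrite lerDr.
Qed.

Lemma beta_kernel_le_inv r x : 0 <= r -> 0 < x -> beta_kernel (r + 1) x <= x^-1.
Proof.
move=> r0 x0; have x1 : 0 < 1 + x by rewrite addr_gt0.
rewrite /beta_kernel addrK -opprD powRN ler_pdivrMr ?powR_gt0 //.
rewrite mulrC ler_pdivlMr // -[X in _ * X]powRr1 ?(ltW x0) // -powRD; last first.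
  by rewrite (gt_eqF x0) implybT.
apply: (@le_trans _ _ ((1 + x) `^ (r + 1))).
  apply: ge0_ler_powR; rewrite ?nnegrE; lra.
by apply: ler_powR; lra.
Qed.

Local Notation gamma_integrand z := (fun x => cpow x (z - 1) * (expR (- x))%:C).

Lemma cderiv_expRN x : cderiv (fun y => (expR (- y))%:C) x (- (expR (- x))%:C).
Proof.
have p : is_derive x (1 : R) (fun y : R => expR (- y)) (- expR (- x)).
  apply: (is_derive_ext (@is_derive1_comp R expR -%R x _ _ (is_derive_expR _)
    (is_deriveNid x 1))) => //.
  by rewrite mulrN1.
by apply: (cderiv_eq (cderiv_real p)); rewrite rmorphN.
Qed.

Lemma gamma_integrand_cvg z x : 0 < x ->
  gamma_integrand z y @[y --> x] --> gamma_integrand z x.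
Proof.
move=> x0.
exact: cderiv_cvg (cderivM (cderiv_cpow (z - 1) x0) (cderiv_expRN x)).
Qed.

Lemma gamma_cintegrable z : 0 < complex.Re z ->
  cintegrable `]0, +oo[ (gamma_integrand z).
Proof.
move=> z0; have [C C0 leC] := le_powR_expR z0.
have mI : measurable (`]0, +oo[%classic : set R) by exact: measurable_itv.
apply: (@dominated_cintegrable _ _ _
  (fun x => (2 * C) * beta_kernel (complex.Re z) x)) => //.
- apply: open_cmeasurable; first exact: rray_open.
  by move=> x /=; rewrite in_itv /= andbT; exact: gamma_integrand_cvg.
- by apply: integrable_scale => //; exact: integrable_beta_kernel.
- move=> x /=; rewrite in_itv /= andbT => x0.
  apply: le_trans (norm1M _ _) _; rewrite norm1_real ger0_norm ?expR_ge0 //.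
  apply: le_trans (ler_wpM2r (expR_ge0 _) (norm1_cpow _ x0)) _.
  rewrite -!mulrA ler_wpM2l // ReD ReN /=; exact: leC.
Qed.

(** Integrate
    [(x ^ z e ^ (- x))' = z x ^ (z - 1) e ^ (- x) - x ^ z e ^ (- x)]
    over the half-line; the boundary terms vanish. *)
Lemma cGamma_rec z : 0 < complex.Re z -> cGamma (z + 1) = z * cGamma z.
Proof.
move=> z0; have z1 : 0 < complex.Re (z + 1) by rewrite ReD /= addr_gt0.
have mI : measurable (`]0, +oo[%classic : set R) by exact: measurable_itv.
have i0 := gamma_cintegrable z0; have i1 := gamma_cintegrable z1.
pose F x : R[i]^o := cpow x z * (expR (- x))%:C.
pose f x : R[i]^o := z * gamma_integrand z x + -1 * gamma_integrand (z + 1) x.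
have F0 : cintegral `]0, +oo[ f = 0.
  apply: (@cintegral_exhaustion _ _ F f (fun n => (n.+1%:R)^-1) (fun n => n.+2%:R)) => //.
  - exact: exhaust_lt.
  - exact: exhaust_sub.
  - by move=> x /=; rewrite in_itv /= andbT; exact: exhaust_gt0.
  - move=> x /=; rewrite in_itv /= andbT => x0.
    apply: (cderiv_eq (cderivM (cderiv_cpow z x0) (cderiv_expRN x))).
    rewrite /f /= addrK mulrN mulN1r; congr (_ - _); exact/esym/mulrA.
  - move=> x /=; rewrite in_itv /= andbT => x0.
    by apply: cvgD; apply: cvg_complexZ; exact: gamma_integrand_cvg.
  - by apply: cintegrableD => //; apply: cintegrableZ.
  - have [C C0 leC] := le_powR_expR (ltr_pwDl z0 ler01).
    pose e n : R := 2 * (C * (n.+2%:R)^-1) + 2 * (n.+1%:R^-1) `^ complex.Re z.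
    apply: (@norm1_squeeze _ _ _ _ _ _ e).
      apply: nearW => n; rewrite sub0r norm1N; apply: le_trans (norm1D _ _) _.
      rewrite norm1N; apply: lerD.
        apply: le_trans (norm1M _ _) _.
        rewrite norm1_real ger0_norm ?expR_ge0 //.
        have y0 : 0 < n.+2%:R :> R by rewrite ltr0n.
        apply: le_trans (ler_wpM2r (expR_ge0 _) (norm1_cpow _ y0)) _.
        rewrite -mulrA ler_wpM2l //.
        have := leC _ y0; rewrite addrK => /le_trans; apply.
        by rewrite ler_wpM2l // beta_kernel_le_inv // ltW.
      apply: le_trans (norm1M _ _) _.
      rewrite norm1_real ger0_norm ?expR_ge0 //.
      have x0 : 0 < n.+1%:R^-1 :> R by rewrite invr_gt0 ltr0n.
      apply: le_trans (ler_wpM2r (expR_ge0 _) (norm1_cpow _ x0)) _.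
      apply: ler_piMr; first by rewrite mulr_ge0 ?powR_ge0.
      by rewrite -[leRHS](expR0 R) ler_expR oppr_le0 ltW.
    rewrite -[X in _ --> X](_ : 2 * (C * 0) + 2 * 0 = 0); last by rewrite !mulr0 addr0.
    have h0 := @cvg_harmonic R.
    apply: cvgD; apply: cvgMr.
      apply: cvgMr; rewrite -(cvg_shiftS (@harmonic R)) in h0; exact: h0.
    have /cvg_at_rightP := powR_cvg0 z0; by apply; split.
apply/eqP; rewrite eq_sym -subr_eq0 -F0; apply/eqP.
rewrite cintegralD //; [|exact: cintegrableZ|exact: cintegrableZ].
by rewrite !cintegralZ // mulN1r.
Qed.

Lemma cGamma_pochhammer z m : 0 < complex.Re z ->
  cGamma (z + m%:R) = pochhammer z m * cGamma z.
Proof.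
move=> z0; elim: m => [|m IH]; first by rewrite addr0 /pochhammer big_ord0 mul1r.
rewrite -natr1 addrA cGamma_rec ?IH; last by rewrite ReD Re_nat ltr_wpDr.
by rewrite /pochhammer big_ord_recr /= mulrA; congr (_ * _); rewrite mulrC.
Qed.

End Gamma.

(** * The remainder of the exponential series *)

Section ExponentialRemainder.
Variable R : realType.
Implicit Types (x : R) (beta : R[i]).

Lemma is_derive_monomial n x :
  is_derive x (1 : R) (fun y => y ^+ n.+1) (n.+1%:R * x ^+ n).
Proof.
apply: (is_derive_ext (is_deriveX n.+1 (is_derive_id x (1 : R)))).
  by move=> y; rewrite fctE.
by rewrite /GRing.scale /= mulr1.
Qed.

Lemma derive_ge0_le (h d : R -> R) x : 0 <= x ->
  (forall y, is_derive y (1 : R) h (d y)) -> (forall y, 0 <= y -> 0 <= d y) ->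
  h 0 <= h x.
Proof.
move=> x0 dh d0; have [|c] := @MVT_segment R h d 0 x x0 (fun y _ => dh y).
  apply: continuous_subspaceT => y; exact: is_derive_cvg (dh y).
rewrite in_itv /= => /andP[c0 _] e; rewrite -subr_ge0 e subr0.
by rewrite mulr_ge0 // d0.
Qed.

Lemma le_monomial_primitive (g d : R -> R) (A : R) n x : 0 <= x ->
  (forall y, is_derive y (1 : R) g (d y)) ->
  (forall y, 0 <= y -> `|d y| <= A * y ^+ n) -> g 0 = 0 ->
  `|g x| <= A * x ^+ n.+1 / n.+1%:R.
Proof.
move=> x0 dg led g0.
have dp y : is_derive y (1 : R) (fun y => A / n.+1%:R * y ^+ n.+1) (A * y ^+ n).
  apply: (is_derive_ext (is_deriveZ (A / n.+1%:R) (is_derive_monomial n y))) => //.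
  by rewrite /GRing.scale /= mulrA divfK ?pnatr_eq0.
have p0 : A / n.+1%:R * 0 ^+ n.+1 = 0 by rewrite expr0n mulr0.
have h1 := @derive_ge0_le _ _ x x0 (fun y => is_deriveB (dp y) (dg y)).
have h2 := @derive_ge0_le _ _ x x0 (fun y => is_deriveD (dp y) (dg y)).
rewrite mulrAC ler_norml; apply/andP; split.
  have := h2 _; rewrite !fctE p0 g0 addr0 -lerBlDl sub0r; apply => y y0.
  by rewrite -lerBlDl sub0r; have := led y y0; rewrite ler_norml => /andP[].
have := h1 _; rewrite !fctE p0 g0 subr0 subr_ge0; apply => y y0.
by rewrite subr_ge0 (le_trans (ler_norm _)) // led.
Qed.

Definition exp_rem beta k x : R[i]^o :=
  cexp (- (beta * x%:C)) - \sum_(m < k) (- beta) ^+ m / m`!%:R * (x ^+ m)%:C.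

Lemma exp_rem0 beta x : exp_rem beta 0 x = cexp (- (beta * x%:C)).
Proof. by rewrite /exp_rem big_ord0 subr0. Qed.

Lemma exp_remS beta k x :
  exp_rem beta k.+1 x = exp_rem beta k x - (- beta) ^+ k / k`!%:R * (x ^+ k)%:C.
Proof. by rewrite /exp_rem big_ord_recr /= opprD addrA. Qed.

Lemma exp_rem_at0 beta k : exp_rem beta k.+1 0 = 0.
Proof.
elim: k => [|k IH]; rewrite exp_remS.
  rewrite exp_rem0 mulr0 oppr0 cexp0 !expr0 fact0 divr1 mul1r.
  by rewrite rmorph1 subrr.
by rewrite IH expr0n mulr0 subr0.
Qed.

(** The predecessor makes sense of the case [k = 0], where the derivative of the
    exponential itself is [- beta] times the exponential. *)
Lemma cderiv_exp_rem beta k x :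
  cderiv (exp_rem beta k) x (- beta * exp_rem beta k.-1 x).
Proof.
elim: k => [|k IH].
  have := cderiv_cexp (- beta) (is_derive_id x (1 : R)).
  rewrite mulr1; have -> : (fun y => cexp (- beta * y%:C)) = exp_rem beta 0.
    by apply/funext => y; rewrite exp_rem0 mulNr.
  by move=> /cderiv_eq; apply; rewrite exp_rem0; congr (_ * cexp _); exact: mulNr.
have -> : exp_rem beta k.+1 =
    (fun y => exp_rem beta k y + - ((- beta) ^+ k / k`!%:R * (y ^+ k)%:C)).
  by apply/funext => y; rewrite exp_remS.
case: k IH => [|k] IH.
  have p : is_derive x (1 : R) (fun y : R => y ^+ 0) 0 by exact: is_derive_cst.
  apply: (cderiv_eq (cderivD IH (cderivN (cderivZ _ (cderiv_real p))))).
  by rewrite rmorph0 mulr0 oppr0 addr0.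
apply: (cderiv_eq (cderivD IH (cderivN (cderivZ _ (cderiv_real
    (is_derive_monomial k x)))))).
rewrite /= [in RHS]exp_remS [RHS]mulrBr; congr (_ - _).
rewrite exprS factS natrM rmorphM /= rmorph_nat.
have k0 : (k.+1%:R : R[i]) != 0 by rewrite pnatr_eq0.
have f0 : (k`!%:R : R[i]) != 0 by rewrite pnatr_eq0 -lt0n fact_gt0.
move: k.+1%:R k`!%:R k0 f0 => K f K0 f0.
by field; rewrite K0 f0.
Qed.

(** Induction on [k]: the remainder of order [k + 1] vanishes at the origin and
    its derivative is [- beta] times the remainder of order [k]. For [k = 0] this
    is where the sign of the real part of [beta] enters. The factor [2 ^ k] is
    lost by bounding real and imaginary parts separately. *)
Lemma norm1_exp_rem beta k x : 0 <= complex.Re beta -> 0 <= x ->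
  norm1 (exp_rem beta k x) <= 2 * (2 * norm1 beta) ^+ k / k`!%:R * x ^+ k.
Proof.
move=> b0; elim: k x => [|k IH] x x0.
  rewrite exp_rem0 !expr0 fact0 !mulr1 divr1.
  apply: le_trans (norm1_cexp _) _; rewrite -[leRHS]mulr1 ler_wpM2l //.
  rewrite -[leRHS](expR0 R) ler_expR ReN ReM /= mulr0 subr0 oppr_le0.
  exact: mulr_ge0.
pose A := norm1 beta * (2 * (2 * norm1 beta) ^+ k / k`!%:R).
have led y : 0 <= y -> norm1 (- beta * exp_rem beta k y) <= A * y ^+ k.
  move=> y0; apply: le_trans (norm1M _ _) _; rewrite norm1N /A -mulrA.
  by rewrite ler_wpM2l ?norm1_ge0 // IH.
have h1 : `|complex.Re (exp_rem beta k.+1 x)| <= A * x ^+ k.+1 / k.+1%:R.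
  apply: (@le_monomial_primitive (fun y => complex.Re (exp_rem beta k.+1 y))
    (fun y => complex.Re (- beta * exp_rem beta k y))
    A k x x0) => [y|y y0|].
  - by have [] := cderiv_exp_rem beta k.+1 y.
  - exact: le_trans (ler_Re_norm1 _) (led y y0).
  - by rewrite exp_rem_at0.
have h2 : `|complex.Im (exp_rem beta k.+1 x)| <= A * x ^+ k.+1 / k.+1%:R.
  apply: (@le_monomial_primitive (fun y => complex.Im (exp_rem beta k.+1 y))
    (fun y => complex.Im (- beta * exp_rem beta k y))
    A k x x0) => [y|y y0|].
  - by have [] := cderiv_exp_rem beta k.+1 y.
  - exact: le_trans (ler_Im_norm1 _) (led y y0).
  - by rewrite exp_rem_at0.
apply: le_trans (lerD h1 h2) _; rewrite le_eqVlt; apply/orP; left; apply/eqP.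
rewrite /A factS natrM [(2 * _) ^+ k.+1]exprS.
have k0 : (k.+1%:R : R) != 0 by rewrite pnatr_eq0.
have f0 : (k`!%:R : R) != 0 by rewrite pnatr_eq0 -lt0n fact_gt0.
move: k.+1%:R k`!%:R k0 f0 => K f K0 f0.
by field; rewrite K0 f0.
Qed.

End ExponentialRemainder.

(** * Reflection of Lebesgue measure *)

Section Reflection.
Variable R : realType.
Local Notation mu := (@lebesgue_measure R).
Implicit Types (s : R) (D : set R).

Let refl s : R -> measurableTypeR R := fun v => s - v.

Let measurable_refl s : measurable_fun [set: R] (refl s).
Proof. by apply: measurable_funB => //; exact: measurable_cst. Qed.

Lemma reflect_preimage s (a b : R) (b0 b1 : bool) :
  (fun v => s - v) @^-1` [set` Interval (BSide b0 a) (BSide b1 b)] =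
  [set` Interval (BSide (~~ b1) (s - b)) (BSide (~~ b0) (s - a))].
Proof.
apply/seteqP; split => v /=; rewrite !itv_boundlr /= /Order.le /=;
  by case: b0 b1 => [] [] /=; lra.
Qed.

(** Reflections preserve the length of intervals, hence Lebesgue measure. They
    turn [int_a^t k(t - u) f(u) du] into [int_0^(t-a) k(v) f(t - v) dv], and two
    of them make a translation. *)
Lemma lebesgue_measure_reflect s D : measurable D ->
  pushforward mu (refl s) D = mu D.
Proof.
move=> mD.
have mp : measurable_fun [set: R] (refl s) := measurable_refl s.
apply/esym; apply: (@lebesgue_measure_unique R (pushforward mu (refl s))) => //=.
move=> _ [[a b]] _ <-.
rewrite /pushforward (_ : refl s @^-1` _ = `[s - b, s - a[%classic); last first.
  exact: reflect_preimage.
rewrite !lebesgue_measure_itv /= !lte_fin.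
have -> : (s - b < s - a) = (a < b) by apply/idP/idP => h; lra.
by case: ifP => // _; rewrite -!EFinB; congr EFin; ring.
Qed.

Lemma ge0_integral_reflect s D (f : R -> \bar R) : measurable D ->
  measurable_fun D f -> (forall x, D x -> (0 <= f x)%E) ->
  (\int[mu]_(x in D) f x =
   \int[mu]_(v in (fun v => (s - v)%R) @^-1` D) f (s - v)%R)%E.
Proof.
move=> mD mf f0.
have := @ge0_integral_pushforward _ _ (measurableTypeR R) (measurableTypeR R)
  R (refl s)
  (measurable_refl s) mu D f mD mf.
rewrite /comp /refl => <-; last by move=> x; rewrite inE; exact: f0.
apply: eq_measure_integral => /=; first exact: measurable_refl.
by move=> ? A mA _; exact/esym/lebesgue_measure_reflect.
Qed.

Lemma Rintegral_reflect s D (f : R -> R) : measurable D -> measurable_fun D f ->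
  Rintegral mu D f =
  Rintegral mu ((fun v => s - v) @^-1` D) (fun v => f (s - v)).
Proof.
move=> mD mf; rewrite /Rintegral; congr fine.
have mEf : measurable_fun D (EFin \o f) by apply/measurable_EFinP; exact: mf.
rewrite [LHS]integralE [RHS]integralE; congr (_ - _)%E.
  rewrite (ge0_integral_reflect s mD (measurable_funepos mEf)); last first.
    by move=> x _; exact: funepos_ge0.
  by apply: eq_integral => v _; rewrite !funeposE.
rewrite (ge0_integral_reflect s mD (measurable_funeneg mEf)); last first.
  by move=> x _; exact: funeneg_ge0.
by apply: eq_integral => v _; rewrite !funenegE.
Qed.

Lemma integrable_reflect s D (f : R -> R) : measurable D ->
  mu.-integrable D (fun x => (f x)%:E) ->
  mu.-integrable ((fun v => s - v) @^-1` D) (fun v => (f (s - v))%:E).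
Proof.
move=> mD /integrableP[mf fi]; apply/integrableP; split.
  apply: (@measurable_comp _ _ _ R R _ D (fun x => (f x)%:E) _ (fun v => s - v)) => //.
  - by move=> _ [v Dv <-].
  - by apply: measurable_funTS; exact: measurable_refl.
rewrite (_ : integral _ _ _ = \int[mu]_(x in D) `|(f x)%:E|)%E //.
rewrite (ge0_integral_reflect s mD) //.
exact: measurableT_comp.
Qed.

End Reflection.

Section ComplexReflection.
Variable R : realType.
Local Notation mu := (@lebesgue_measure R).

Lemma cintegral_reflect (s : R) (D : set R) (g : R -> R[i]^o) : measurable D ->
  cmeasurable D g ->
  cintegral D g = cintegral ((fun v => s - v) @^-1` D) (fun v => g (s - v)).
Proof.
move=> mD [g1 g2]; rewrite /cintegral; congr (_ +i* _).
  exact: (Rintegral_reflect s mD g1).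
exact: (Rintegral_reflect s mD g2).
Qed.

Lemma cintegral_itv_oo (a b : R) (b0 b1 : bool) (g : R -> R[i]^o) :
  cmeasurable `]a, b[ g ->
  cintegral [set` Interval (BSide b0 a) (BSide b1 b)] g = cintegral `]a, b[ g.
Proof.
move=> [g1 g2]; rewrite /cintegral /Rintegral; congr (fine _ +i* fine _).
  by apply: integral_itv_bndoo; apply/measurable_EFinP.
by apply: integral_itv_bndoo; apply/measurable_EFinP.
Qed.

End ComplexReflection.

(** * Difference quotients and one-sided derivatives *)

Section DifferenceQuotients.
Variable R : realType.
Implicit Types (t s : R).

Lemma cvg_shift_dnbhs t : (s - t) @[s --> t^'] --> (0 : R)^'.
Proof.
move=> A; rewrite /nbhs /= => -[e /= e0 eA]; exists e => //= s ts st.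
apply: eA; last by rewrite subr_eq0.
by rewrite /= sub0r opprB.
Qed.

Lemma cvg_unshift_dnbhs t : (h + t) @[h --> (0 : R)^'] --> t^'.
Proof.
move=> A; rewrite /nbhs /= => -[e /= e0 eA]; exists e => //= h h0 hn0.
apply: eA => /=; last by rewrite -subr_eq0 addrK.
by move: h0; rewrite /= sub0r normrN opprD addrCA subrr addr0 normrN.
Qed.

Lemma is_derive_quotP (g : R -> R) t d :
  is_derive t (1 : R) g d <-> (g s - g t) / (s - t) @[s --> t^'] --> d.
Proof.
pose q h := h^-1 *: ((g \o shift t) (h *: (1 : R)) - g t).
have qE h : q h = (g (h + t) - g t) / (h + t - t).
  by rewrite /q /= /GRing.scale /= mulr1 addrK mulrC.
have qF : q = fun h => (g (h + t) - g t) / (h + t - t) by apply/funext.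
split=> [[h1 h2]|h].
  have cq : q h @[h --> 0^'] --> d.
    by rewrite -h2; apply: (cvg_toP h1).
  have := cvg_comp _ _ (@cvg_shift_dnbhs t) cq.
  rewrite (_ : q \o _ = fun s => (g s - g t) / (s - t)) //.
  by apply/funext => s /=; rewrite qE subrK.
have cq : q h @[h --> 0^'] --> d.
  rewrite qF; exact: (cvg_comp _ _ (@cvg_unshift_dnbhs t) h).
split; first by apply/cvg_ex; exists d.
exact: (cvg_lim _ cq).
Qed.

(** Dominated convergence is about sequences; this brings it to difference
    quotients. *)
Lemma within_seq_cvg (A : set R) (g : R -> R) t (l : R) :
  (forall s_ : nat -> R, (forall n, A (s_ n)) -> (forall n, s_ n != t) ->
     s_ n @[n --> \oo] --> t -> g (s_ n) @[n --> \oo] --> l) ->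
  g s @[s --> within A t^'] --> l.
Proof.
move=> H; apply/cvgrPdist_lt => e e0; apply: contrapT => ne.
have bad n : exists s, [/\ A s, s != t, `|t - s| < n.+1%:R^-1 & e <= `|l - g s|].
  apply: contrapT => nex; apply: ne.
  exists (n.+1%:R^-1) => /=; first by rewrite invr_gt0 ltr0n.
  move=> s /= ts st As; rewrite ltNge; apply/negP => le; apply: nex; exists s.
  by split.
have [s_ Hs] := choice bad.
have cs : s_ n @[n --> \oo] --> t.
  apply/cvgrPdist_lt => eps eps0.
  have /cvgrPdist_lt/(_ eps eps0) := @cvg_harmonic R.
  apply: filterS => n; rewrite sub0r normrN ger0_norm ?invr_ge0 //.
  by apply: lt_trans; have [_ _ + _] := Hs n.
have := H s_ (fun n => let: And4 h _ _ _ := Hs n in h)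
  (fun n => let: And4 _ h _ _ := Hs n in h) cs.
move=> /cvgrPdist_lt/(_ e e0)[N _ /(_ N (leqnn N))] /=.
by have [_ _ _] := Hs N; rewrite leNgt => /negP.
Qed.

End DifferenceQuotients.

Section OneSidedDerivative.
Variables (R : realType) (a b : R).
Hypothesis hab : a < b.
Implicit Types (g h : R -> R[i]^o) (t s : R) (l m : R[i]^o) (z : R[i]).

Definition wderiv g t l : Prop :=
  diff_quot g t s @[s --> within `[a, b] t^'] --> l.

Lemma within_itv_proper t : t \in `[a, b] ->
  ProperFilter (within `[a, b] t^').
Proof.
rewrite in_itv /= => /andP[ta tb].
apply: Build_ProperFilter_ex => P [e /= e0 eP].
have [tb'|bt] := ltP t b.
  exists (Num.min (t + e / 2) b).
  have e2 : 0 < e / 2 by rewrite divr_gt0.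
  have m1 : t < Num.min (t + e / 2) b by rewrite lt_min tb' ltrDl e2.
  have m2 : Num.min (t + e / 2) b <= t + e / 2 by rewrite ge_min lexx.
  apply: eP => /=.
  - by rewrite ltr0_norm ?subr_lt0 //; lra.
  - by rewrite gt_eqF.
  - by rewrite in_itv /= ge_min lexx orbT andbT (le_trans ta) // ltW.
have tE : t = b by apply/eqP; rewrite eq_le tb bt.
exists (Num.max (t - e / 2) a).
have e2 : 0 < e / 2 by rewrite divr_gt0.
have m1 : Num.max (t - e / 2) a < t.
  have at_ : a < t by rewrite tE.
  by rewrite gt_max at_ andbT; lra.
have m2 : t - e / 2 <= Num.max (t - e / 2) a by rewrite le_max lexx.
apply: eP => /=.
- by rewrite gtr0_norm ?subr_gt0 //; lra.
- by rewrite lt_eqF.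
- by rewrite in_itv /= le_max lexx orbT /= (le_trans _ tb) // ltW.
Qed.

Lemma wderiv_deriv_on g t l : t \in `[a, b] -> wderiv g t l ->
  deriv_on a b g t = l.
Proof.
move=> tab gl; have PF := within_itv_proper tab.
exact: (cvg_lim (@norm_hausdorff _ _) gl).
Qed.

Lemma derivable_on_wderiv g t : derivable_on a b g t ->
  wderiv g t (deriv_on a b g t).
Proof. by move=> h; apply: (cvg_toP h). Qed.

Lemma diff_quot_ReIm g t s :
  complex.Re (diff_quot g t s) =
    (complex.Re (g s) - complex.Re (g t)) / (s - t) /\
  complex.Im (diff_quot g t s) =
    (complex.Im (g s) - complex.Im (g t)) / (s - t).
Proof.
have -> : diff_quot g t s = (g s - g t) * ((s - t)^-1)%:C.
  by rewrite /diff_quot fmorphV.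
rewrite ReM ImM /= !ReD !ImD !ReN !ImN !mulr0 subr0 add0r; split => //.
Qed.

Lemma diff_quotE g t s :
  diff_quot g t s = (g s - g t) * ((s - t)^-1)%:C.
Proof. by rewrite /diff_quot fmorphV. Qed.

Lemma wderivP g t l : wderiv g t l <->
  ((complex.Re (g s) - complex.Re (g t)) / (s - t)
     @[s --> within `[a, b] t^'] --> complex.Re l /\
   (complex.Im (g s) - complex.Im (g t)) / (s - t)
     @[s --> within `[a, b] t^'] --> complex.Im l).
Proof.
rewrite /wderiv cvg_complexP.
have -> : (fun s => complex.Re (diff_quot g t s)) =
    fun s => (complex.Re (g s) - complex.Re (g t)) / (s - t).
  by apply/funext => s; have [] := diff_quot_ReIm g t s.
have -> // : (fun s => complex.Im (diff_quot g t s)) =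
    fun s => (complex.Im (g s) - complex.Im (g t)) / (s - t).
by apply/funext => s; have [] := diff_quot_ReIm g t s.
Qed.

Lemma cderiv_wderiv g t l : cderiv g t l -> wderiv g t l.
Proof.
move=> [/is_derive_quotP h1 /is_derive_quotP h2]; apply/wderivP.
by split; exact: cvg_within_filter.
Qed.

Lemma wderiv_cderiv g t l : t \in `]a, b[ -> wderiv g t l -> cderiv g t l.
Proof.
move=> tab /wderivP.
suff -> : within `[a, b] t^' = t^'.
  by move=> [h1 h2]; split; apply/is_derive_quotP.
apply/seteqP; split => P; last by apply: filterS => s Ps _.
have : \forall s \near t^', s \in `[a, b].
  apply: (@cvg_within _ (nbhs t)).
  have := near_in_itvoo tab; apply: filterS => s.
  exact: subset_itv_oo_cc.
by move=> h1 h2; apply: filterS2 h1 h2 => s sab; apply.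
Qed.

(** Equality at [a] is not asked: the functions differentiated below are only
    controlled on ]a, b], and [t > a] has a neighbourhood that avoids [a]. *)
Lemma eq_wderiv g h t l : t \in `]a, b] -> {in `]a, b], g =1 h} ->
  wderiv g t l -> wderiv h t l.
Proof.
move=> tab gh; apply: cvg_trans; apply: near_eq_cvg.
have ta : a < t by move: tab; rewrite in_itv => /andP[].
have : \forall s \near within `[a, b] t^', a < s.
  apply: (@cvg_within _ t^'); apply: (@cvg_within _ (nbhs t)).
  exact: lt_nbhsr.
have : \forall s \near within `[a, b] t^', s \in `[a, b].
  by near=> s; near: s; exact: withinT.
apply: filterS2 => s; rewrite in_itv /= => /andP[_ sb] sa.
by rewrite /diff_quot !gh // in_itv /= sa.
Unshelve. all: by end_near. Qed.

Lemma wderivD g h t l m : wderiv g t l -> wderiv h t m ->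
  wderiv (fun s => g s + h s) t (l + m).
Proof.
move=> hg hh; rewrite /wderiv.
rewrite (_ : diff_quot _ t = fun s => diff_quot g t s + diff_quot h t s).
  exact: (cvg_complexD hg hh).
by apply/funext => s; rewrite !diff_quotE -mulrDl opprD addrACA.
Qed.

Lemma wderivZ z g t l : wderiv g t l -> wderiv (fun s => z * g s) t (z * l).
Proof.
move=> hg; rewrite /wderiv.
rewrite (_ : diff_quot _ t = fun s => z * diff_quot g t s).
  exact: (cvg_complexZ (z := z) hg).
by apply/funext => s; rewrite !diff_quotE -mulrBr mulrA.
Qed.

End OneSidedDerivative.

(** * Convolution with a singular kernel *)

Section WithinContinuity.
Variable R : realType.
Implicit Types (a b u v : R) (A : set R) (g : R -> R[i]^o).

Lemma within_continuous_ReIm A g : {within A, continuous g} ->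
  {within A, continuous (fun u => complex.Re (g u))} /\
  {within A, continuous (fun u => complex.Im (g u))}.
Proof.
by move=> cg; split=> u; have /cvg_complexP[] := cg u.
Qed.

Lemma within_continuous_bounded a b g : a <= b ->
  {within `[a, b], continuous g} ->
  exists2 M, 0 <= M & forall u, u \in `[a, b] -> norm1 (g u) <= M.
Proof.
move=> ab /within_continuous_ReIm[c1 c2].
have cn : {within `[a, b], continuous (fun u => norm1 (g u))}.
  by move=> u; apply: cvgD; apply: cvg_norm; [exact: c1|exact: c2].
have [c _ cM] := EVT_max ab cn.
by exists (norm1 (g c)); [exact: norm1_ge0|exact: cM].
Qed.

Lemma within_continuous_cmeasurable a b g : {within `[a, b], continuous g} ->
  cmeasurable `[a, b] g.
Proof.
move=> /within_continuous_ReIm[c1 c2].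
by split; apply: subspace_continuous_measurable_fun.
Qed.

(** The derivative is two-sided in the interior and only continuity is asked at
    the endpoints: this is the form that suits the mean value theorem. *)
Definition C1_on a b (f f' : R -> R[i]^o) : Prop :=
  [/\ forall u, u \in `]a, b[ -> cderiv f u (f' u),
      {within `[a, b], continuous f} & {within `[a, b], continuous f'}].

Lemma C1_on_lipschitz a b f f' : a < b -> C1_on a b f f' ->
  exists2 M, 0 <= M & forall u v, u \in `[a, b] -> v \in `[a, b] ->
    norm1 (f u - f v) <= M * `|u - v|.
Proof.
move=> ab [df /within_continuous_ReIm[c1 c2] cf'].
have [M M0 leM] := within_continuous_bounded (ltW ab) cf'.
have half (h d : R -> R) u v : {within `[a, b], continuous h} ->
    (forall w, w \in `]a, b[ -> is_derive w (1 : R) h (d w)) ->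
    (forall w, w \in `[a, b] -> `|d w| <= M) ->
    u \in `[a, b] -> v \in `[a, b] -> `|h u - h v| <= M * `|u - v|.
  move=> ch dh ledM; wlog uv : u v / u <= v.
    move=> H ua va; have [uv|vu] := leP u v; first exact: H.
    by rewrite distrC [`|u - v|]distrC; apply: H => //; exact: ltW.
  rewrite !in_itv /= => /andP[au _] /andP[_ vb].
  have sub w : w \in `[u, v] -> w \in `[a, b].
    by rewrite !in_itv /= => /andP[uw wv]; rewrite (le_trans au) // (le_trans wv).
  have dh' w : w \in `]u, v[ -> is_derive w (1 : R) h (d w).
    rewrite in_itv /= => /andP[uw wv]; apply: dh.
    by rewrite in_itv /= (le_lt_trans au) // (lt_le_trans wv).
  have ch' : {within `[u, v], continuous h}.
    by apply: continuous_subspaceW ch => w /=; exact: sub.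
  have [w wuv e] := MVT_segment uv dh' ch'.
  rewrite distrC e [`|u - v|]distrC normrM ler_wpM2r //.
  by apply: ledM; exact: sub.
exists (M + M) => [|u v ua va]; first exact: addr_ge0.
rewrite /norm1 ReD ImD ReN ImN mulrDl; apply: lerD.
  apply: (half (fun w => complex.Re (f w)) (fun w => complex.Re (f' w))) => // w.
    by move=> /df[].
  by move=> /leM; exact: le_trans (ler_Re_norm1 _).
apply: (half (fun w => complex.Im (f w)) (fun w => complex.Im (f' w))) => // w.
  by move=> /df[].
by move=> /leM; exact: le_trans (ler_Im_norm1 _).
Qed.

End WithinContinuity.

Section Convolution.
Variable R : realType.
Local Notation mu := (@lebesgue_measure R).
Implicit Types (a t r x u v : R) (k f : R -> R[i]^o) (z : R[i]).

(** For [r > 0] these kernels have an integrable singularity at the origin, and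
    for [r > 1] they vanish there. The kernels of all the fractional and tempered
    operators below belong to such a class. *)
Definition kernel r k : Prop :=
  (forall x, 0 < x -> k y @[y --> x] --> k x) /\
  (forall L, exists2 C, 0 <= C & forall x, 0 < x -> x <= L ->
    norm1 (k x) <= C * x `^ (r - 1)).

Definition conv a k f t : R[i]^o := cintegral `[a, t] (fun u => k (t - u) * f u).

(** What is needed for [int_a^t k(t - u) f(u) du] to converge absolutely at the
    given [t] for all kernels of exponent [r]. It holds at every [t] for
    continuous [f], and at almost every [t] for integrable [f]. *)
Definition admissible r f a t : Prop :=
  cmeasurable `]a, t[ f /\
  mu.-integrable `]a, t[ (fun u => ((t - u) `^ (r - 1) * norm1 (f u))%:E).

Lemma kernelD r k k' : kernel r k -> kernel r k' ->
  kernel r (fun x => k x + k' x).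
Proof.
move=> [ck bk] [ck' bk']; split=> [x x0|L].
  exact: cvg_complexD (ck x x0) (ck' x x0).
have [C C0 leC] := bk L; have [C' C'0 leC'] := bk' L.
exists (C + C') => [|x x0 xL]; first exact: addr_ge0.
rewrite mulrDl; apply: le_trans (norm1D _ _) _.
by apply: lerD; [exact: leC|exact: leC'].
Qed.

Lemma kernelZ r z k : kernel r k -> kernel r (fun x => z * k x).
Proof.
move=> [ck bk]; split=> [x x0|L]; first exact: cvg_complexZ (ck x x0).
have [C C0 leC] := bk L.
exists (norm1 z * C) => [|x x0 xL]; first by rewrite mulr_ge0 ?norm1_ge0.
apply: le_trans (norm1M _ _) _; rewrite -mulrA ler_wpM2l ?norm1_ge0 //.
exact: leC.
Qed.

Lemma itv_oo_measurable (a b : R) : measurable (`]a, b[%classic : set R).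
Proof. exact: measurable_itv. Qed.

Lemma kernel_cmeasurable r k a t : kernel r k ->
  cmeasurable `]a, t[ (fun u => k (t - u)).
Proof.
move=> [ck _]; apply: open_cmeasurable; first exact: itv_open.
move=> u /=; rewrite in_itv /= => /andP[_ ut].
have c : (t - w) @[w --> u] --> t - u.
  by apply: cvgB; [exact: cvg_cst|exact: cvg_id].
by apply: (cvg_comp _ _ c); apply: ck; rewrite subr_gt0.
Qed.

Lemma conv_cmeasurable r k f a t : kernel r k -> cmeasurable `]a, t[ f ->
  cmeasurable `]a, t[ (fun u => k (t - u) * f u).
Proof. by move=> kk mf; apply: cmeasurableM => //; exact: kernel_cmeasurable kk. Qed.

Lemma conv_cintegrable r k f a t : kernel r k -> admissible r f a t ->
  cintegrable `]a, t[ (fun u => k (t - u) * f u).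
Proof.
move=> kk [mf jf]; have [C C0 leC] := kk.2 (t - a).
apply: (dominated_cintegrable (itv_oo_measurable a t) (conv_cmeasurable kk mf)
  (integrable_scale C (itv_oo_measurable a t) jf)).
move=> u /=; rewrite in_itv /= => /andP[au ut].
apply: le_trans (norm1M _ _) _; rewrite mulrA ler_wpM2r ?norm1_ge0 //.
by apply: leC; rewrite ?subr_gt0 // lerD2l lerN2 ltW.
Qed.

Lemma convE r k f a t : kernel r k -> cmeasurable `]a, t[ f ->
  conv a k f t = cintegral `]a, t[ (fun u => k (t - u) * f u).
Proof. by move=> kk mf; apply: cintegral_itv_oo; exact: conv_cmeasurable kk mf. Qed.

Lemma convD r k k' f a t : kernel r k -> kernel r k' -> admissible r f a t ->
  conv a (fun x => k x + k' x) f t = conv a k f t + conv a k' f t.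
Proof.
move=> kk kk' af; have [mf _] := af.
rewrite (convE (kernelD kk kk') mf) (convE kk mf) (convE kk' mf).
rewrite -cintegralD; first by apply: eq_cintegral => u _; rewrite mulrDl.
- exact: itv_oo_measurable.
- exact: conv_cintegrable kk af.
- exact: conv_cintegrable kk' af.
Qed.

Lemma convZ r z k f a t : kernel r k -> admissible r f a t ->
  conv a (fun x => z * k x) f t = z * conv a k f t.
Proof.
move=> kk af; have [mf _] := af.
rewrite (convE (kernelZ z kk) mf) (convE kk mf).
rewrite -cintegralZ; first by apply: eq_cintegral => u _; rewrite mulrA.
- exact: itv_oo_measurable.
- exact: conv_cintegrable kk af.
Qed.

Lemma eq_conv r k k' f a t : kernel r k -> kernel r k' ->
  cmeasurable `]a, t[ f -> (forall x, 0 < x -> k x = k' x) ->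
  conv a k f t = conv a k' f t.
Proof.
move=> kk kk' mf kE; rewrite (convE kk mf) (convE kk' mf).
apply: eq_cintegral => u; rewrite inE /= in_itv /= => /andP[_ ut].
by rewrite kE // subr_gt0.
Qed.

Lemma reflect_itv_oo a t : (fun v => t - v) @^-1` `]a, t[ = `]0, t - a[%classic.
Proof. by rewrite reflect_preimage subrr. Qed.

Lemma reflect_itv_oo0 a t : (fun v => t - v) @^-1` `]0, t - a[ = `]a, t[%classic.
Proof. by rewrite reflect_preimage subr0 subKr. Qed.

Lemma conv_reflect r k f a t : kernel r k -> cmeasurable `]a, t[ f ->
  conv a k f t = cintegral `]0, t - a[ (fun v => k v * f (t - v)).
Proof.
move=> kk mf; rewrite (convE kk mf).
rewrite (cintegral_reflect t (itv_oo_measurable a t) (conv_cmeasurable kk mf)).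
rewrite reflect_itv_oo; apply: eq_cintegral => v _.
by rewrite opprB addrCA subrr addr0.
Qed.

Lemma integrable_powR_oo r (L : R) : 0 < r ->
  mu.-integrable `]0, L[ (fun x => (x `^ (r - 1))%:E).
Proof.
move=> r0; apply: (@integrableS _ _ _ mu `]0, L] `]0, L[) => //.
  exact: subset_itv_oo_oc.
exact: integrable_powR.
Qed.

Lemma admissible_bounded r f a t (M : R) : 0 < r -> cmeasurable `]a, t[ f ->
  (forall u, u \in `]a, t[ -> norm1 (f u) <= M) -> admissible r f a t.
Proof.
move=> r0 mf leM; split => //.
have ip : mu.-integrable `]a, t[ (fun u => ((t - u) `^ (r - 1))%:E).
  have := integrable_reflect t (itv_oo_measurable 0 (t - a))
    (integrable_powR_oo (t - a) r0).
  by rewrite reflect_itv_oo0.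
apply: (dominated_integrable _ _ (integrable_scale M _ ip)) => //.
- apply: measurable_funM; last exact: cmeasurable_norm1.
  by apply/measurable_EFinP; exact: measurable_int ip.
- move=> u uat; rewrite ger0_norm ?mulr_ge0 ?powR_ge0 ?norm1_ge0 //.
  by rewrite mulrC ler_wpM2r ?powR_ge0 // leM.
Qed.

Lemma admissible_continuous r f a b t : 0 < r -> a < b ->
  {within `[a, b], continuous f} -> t \in `[a, b] -> admissible r f a t.
Proof.
move=> r0 ab cf; rewrite in_itv /= => /andP[_ tb].
have [M M0 leM] := within_continuous_bounded (ltW ab) cf.
have sub u : u \in `]a, t[ -> u \in `[a, b].
  by rewrite !in_itv /= => /andP[au ut]; rewrite !ltW // (lt_le_trans ut).
apply: (@admissible_bounded _ _ _ _ M) => //.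
  apply: cmeasurableS (within_continuous_cmeasurable cf) => //.
by move=> u /sub; exact: leM.
Qed.

End Convolution.

(** * Primitive of a kernel and extension by constants *)

Section IntegralSets.
Variable R : realType.
Local Notation mu := (@lebesgue_measure R).
Implicit Types (D : set R) (g h : R -> R[i]^o).

Lemma cintegral_extend D D' g h : D' `<=` D ->
  {in D', g =1 h} -> (forall x, D x -> ~ D' x -> h x = 0) ->
  cintegral D' g = cintegral D h.
Proof.
move=> sD gh h0; rewrite /cintegral /Rintegral; congr (fine _ +i* fine _).
  rewrite -[in LHS](setIidr sD) integral_mkcondr; apply: eq_integral => x Dx.
  rewrite patchE; case: ifPn => [/gh -> //|nD].
  by rewrite h0 //; [rewrite -inE|move=> /mem_set; rewrite (negbTE nD)].
rewrite -[in LHS](setIidr sD) integral_mkcondr; apply: eq_integral => x Dx.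
rewrite patchE; case: ifPn => [/gh -> //|nD].
by rewrite h0 //; [rewrite -inE|move=> /mem_set; rewrite (negbTE nD)].
Qed.

Lemma cintegral_setD1 D (p : R) g : measurable D -> cmeasurable D g ->
  cintegral (D `\ p) g = cintegral D g.
Proof.
move=> mD mg; have mD1 : measurable (D `\ p) by exact: measurableD.
have [g1 g2] := cmeasurableS mD (@subDsetl _ D [set p]) mg.
rewrite /cintegral /Rintegral; congr (fine _ +i* fine _).
  by apply: integral_setD1 => //; apply/measurable_EFinP.
by apply: integral_setD1 => //; apply/measurable_EFinP.
Qed.

Lemma within_seq_cvg_complex (A : set R) g (t : R) (l : R[i]^o) :
  (forall s_ : nat -> R, (forall n, A (s_ n)) -> (forall n, s_ n != t) ->
     s_ n @[n --> \oo] --> t -> g (s_ n) @[n --> \oo] --> l) ->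
  g s @[s --> within A t^'] --> l.
Proof.
move=> H; apply/cvg_complexP; split; apply: within_seq_cvg => s_ h1 h2 h3.
  by have /cvg_complexP[] := H s_ h1 h2 h3.
by have /cvg_complexP[] := H s_ h1 h2 h3.
Qed.

Lemma kernel_primitive r (k : R -> R[i]^o) (x : R) : 0 < r -> kernel r k ->
  0 < x -> cderiv (fun y => cintegral `]0, y[ k) x (k x).
Proof.
move=> r0 kk x0; have [ck bk] := kk; have [C C0 leC] := bk (x + 1).
have mk y : cmeasurable `]0, y[ k.
  apply: open_cmeasurable; first exact: itv_open.
  by move=> u /=; rewrite in_itv /= => /andP[u0 _]; exact: ck.
have mk' : cmeasurable `]0, x + 1] k.
  apply: (@cmeasurableS _ `]0, x + 1 + 1[) => //.
  by move=> u /=; rewrite !in_itv /= => /andP[-> h]; lra.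
have [i1 i2] : cintegrable `]0, x + 1] k.
  apply: (dominated_cintegrable _ mk'
    (integrable_scale C _ (integrable_powR (x + 1) r0))) => //.
  by move=> u /=; rewrite in_itv /= => /andP[u0 ux]; exact: leC.
have -> : (fun y => cintegral `]0, y[ k) = (fun y => cintegral `]0, y] k).
  by apply/funext => y; rewrite (@cintegral_itv_oo _ 0 y false false).
have /cvg_complexP[c1 c2] := ck x x0.
have x1 : x < x + 1 by rewrite ltrDl.
split.
  have [h1 h2] := @continuous_FTC1 R _ (BRight 0) x (x + 1) x1 i1 x0 c1.
  by split; [exact: h1|rewrite -derive1E; exact: h2].
have [h1 h2] := @continuous_FTC1 R _ (BRight 0) x (x + 1) x1 i2 x0 c2.
by split; [exact: h1|rewrite -derive1E; exact: h2].
Qed.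

End IntegralSets.

Section Clamp.
Variables (R : realType) (a b : R).
Hypothesis ab : a < b.

Definition clamp (u : R) := Num.max a (Num.min b u).

Lemma clamp_in u : clamp u \in `[a, b].
Proof.
rewrite in_itv /= /clamp le_max lexx /= ge_max (ltW ab) /=.
by rewrite ge_min lexx.
Qed.

Lemma clamp_id u : u \in `[a, b] -> clamp u = u.
Proof.
by rewrite in_itv /= => /andP[au ub]; rewrite /clamp (min_idPr ub) (max_idPr au).
Qed.

Lemma clamp_le u : u <= a -> clamp u = a.
Proof.
move=> ua; rewrite /clamp (min_idPr (le_trans ua (ltW ab))).
exact/max_idPl.
Qed.

Lemma clamp_lipschitz u v : `|clamp u - clamp v| <= `|u - v|.
Proof.
rewrite /clamp; wlog uv : u v / u <= v.
  move=> H; have [uv|vu] := leP u v; first exact: H.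
  by rewrite distrC [`|u - v|]distrC; apply: H; exact: ltW.
rewrite distrC [`|u - v|]distrC [leRHS]ger0_norm ?subr_ge0 //.
rewrite ler_norml.
by case: (leP b u) => bu; case: (leP b v) => bv; rewrite ?maxEle;
  do ?[case: ifP => ?]; lra.
Qed.

End Clamp.

(** * Derivative of a convolution, on the side of the function *)

Section ConvolutionDerivative.
Variables (R : realType) (a b : R).
Hypothesis ab : a < b.
Local Notation mu := (@lebesgue_measure R).
Variables (r : R) (k f f' : R -> R[i]^o).
Hypotheses (r0 : 0 < r) (kk : kernel r k) (ff' : C1_on a b f f').

(* Extension by constants keeps [F] Lipschitz on the line. As [F] vanishes on the
   left of [a], the domain of integration in [G] below does not depend on [s]. *)
Let F (u : R) : R[i]^o := f (clamp a b u) - f a.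
Let L := b - a.
Let E := `]0, L[%classic : set R.

Let EP v : E v -> 0 < v /\ v < L.
Proof.
by change (v \in `]0, L[ -> 0 < v /\ v < L); rewrite in_itv /= => /andP[].
Qed.

Let mE : measurable E. Proof. exact: measurable_itv. Qed.

Let F_id u : u \in `[a, b] -> F u = f u - f a.
Proof. by move=> uab; rewrite /F clamp_id. Qed.

Let F_le u : u <= a -> F u = 0.
Proof. by move=> ua; rewrite /F clamp_le // subrr. Qed.

Let F_lipschitz : exists2 M, 0 <= M &
  forall u v, norm1 (F u - F v) <= M * `|u - v|.
Proof.
have [M M0 leM] := C1_on_lipschitz ab ff'.
exists M => // u v; have -> : F u - F v = f (clamp a b u) - f (clamp a b v).
  by rewrite /F opprB addrA subrK.
apply: le_trans (leM _ _ (clamp_in ab u) (clamp_in ab v)) _.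
by rewrite ler_wpM2l // clamp_lipschitz.
Qed.

Let F_continuous u : F w @[w --> u] --> F u.
Proof.
have [M M0 leM] := F_lipschitz.
apply: (@norm1_squeeze _ _ _ _ _ _ (fun w => M * `|u - w|)).
  by apply: nearW => w; exact: leM.
have h : (u - w) @[w --> u] --> u - u.
  by apply: cvgB; [exact: cvg_cst|exact: cvg_id].
have := cvgM (cvg_cst M) (cvg_norm h).
by rewrite subrr normr0 mulr0; apply.
Qed.

Let F_shift_cmeasurable (s : R) : cmeasurable E (fun v => F (s - v)).
Proof.
apply: open_cmeasurable; first exact: itv_open.
move=> v _; have h : (s - w) @[w --> v] --> s - v.
  by apply: cvgB; [exact: cvg_cst|exact: cvg_id].
exact: (cvg_comp _ _ h (@F_continuous (s - v))).
Qed.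

Let k_cmeasurable : cmeasurable E k.
Proof.
apply: open_cmeasurable; first exact: itv_open.
by move=> v /EP[v0 _]; exact: kk.1.
Qed.

Let k_dominated (z : R -> R[i]^o) (M : R) : cmeasurable E z ->
  (forall v, E v -> norm1 (z v) <= M) -> cintegrable E (fun v => k v * z v).
Proof.
move=> mz leM; have [C C0 leC] := kk.2 L.
apply: (dominated_cintegrable mE (cmeasurableM k_cmeasurable mz)
  (integrable_scale (C * M) mE (integrable_powR_oo L r0))).
move=> v Ev; have [v0 vL] := EP Ev.
apply: le_trans (norm1M _ _) _; rewrite mulrAC.
by apply: ler_pM; rewrite ?norm1_ge0 ?leM ?leC // ltW.
Qed.

Let G (s : R) : R[i]^o := cintegral E (fun v => k v * F (s - v)).

Let G_cintegrable (s : R) : cintegrable E (fun v => k v * F (s - v)).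
Proof.
have [M M0 leM] := F_lipschitz.
apply: (@k_dominated _ (M * (`|s| + `|a| + L))); first exact: F_shift_cmeasurable.
move=> v /EP[v0 vL].
rewrite -[F _]subr0 -(@F_le a) //; apply: le_trans (leM _ _) _.
rewrite ler_wpM2l //; apply: le_trans (ler_normB _ _) _.
rewrite -addrA [`|a| + _]addrC addrA lerD2r.
by apply: le_trans (ler_normB _ _) _; rewrite lerD2l gtr0_norm // ltW.
Qed.

Let conv_split (s : R) : s \in `[a, b] ->
  conv a k f s = f a * cintegral `]0, s - a[ k + G s.
Proof.
move=> sab; have [_ cf _] := ff'.
move: (sab); rewrite in_itv /= => /andP[as_ sb].
have [mf _] := admissible_continuous r0 ab cf sab.
have mI := itv_oo_measurable 0 (s - a).
have sub : `]0, s - a[ `<=` E.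
  move=> v; rewrite /E /L /= !in_itv /= => /andP[-> vs].
    by rewrite (lt_le_trans vs) // lerD2r.
have ik : cintegrable `]0, s - a[ k.
  have i1 : cintegrable E (fun v => k v * 1).
    apply: (@k_dominated _ 1); first exact: cmeasurable_cst.
    by move=> v _; rewrite /norm1 /= normr1 normr0 addr0.
  apply: cintegrableS mE mI sub _.
  by apply: eq_cintegrable i1 => // v _; rewrite mulr1.
have iF := cintegrableS mE mI sub (G_cintegrable s).
rewrite (conv_reflect kk mf).
transitivity (cintegral `]0, s - a[ (fun v => f a * k v + k v * F (s - v))).
  apply: eq_cintegral => v; rewrite inE /= in_itv /= => /andP[v0 vs].
  rewrite F_id; last by rewrite in_itv /=; lra.
  by rewrite mulrBr [f a * _]mulrC [RHS]addrC subrK.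
rewrite cintegralD //; last exact: cintegrableZ.
rewrite cintegralZ //; congr (_ + _).
apply: cintegral_extend => // v Ev nv; rewrite F_le ?mulr0 //.
have [v0 _] := EP Ev.
by have [//|h] := leP (s - v) a; exfalso; apply: nv; rewrite /= in_itv /=; lra.
Qed.

(** Differentiation under the integral sign: the difference quotients of the
    Lipschitz function [F] are bounded, so convergence is dominated by the
    kernel; the kink of [F] at [a] is a null set of the integration variable. *)
Let G_wderiv (t : R) : t \in `]a, b] -> wderiv a b G t (conv a k f' t).
Proof.
move=> tab; move: (tab); rewrite in_itv /= => /andP[at_ tb].
have tab' : t \in `[a, b] by rewrite in_itv /= tb ltW.
have [df cf cf'] := ff'; have [M M0 leM] := F_lipschitz.
pose D := E `\ (t - a).
have mD : measurable D by apply: measurableD.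
have DE : D `<=` E by apply: subDsetl.
pose q s v : R[i]^o := (F (s - v) - F (t - v)) * ((s - t)^-1)%:C.
pose q' v : R[i]^o := if v < t - a then f' (t - v) else 0.
have mq s : cmeasurable E (q s).
  apply: cmeasurableM; last exact: cmeasurable_cst.
  apply: cmeasurableD => //.
  rewrite (_ : (fun v => _) = fun v => -1 * F (t - v)); last first.
    by apply/funext => v; rewrite mulN1r.
  exact: cmeasurableZ.
have leq s v : s != t -> norm1 (q s v) <= M.
  move=> st; apply: le_trans (norm1M _ _) _.
  have st0 : 0 < `|s - t| by rewrite normr_gt0 subr_eq0.
  rewrite norm1_real normfV ler_pdivrMr //; apply: le_trans (leM _ _) _.
  by rewrite opprB addrA subrK.
have iq s : cintegrable E (fun v => k v * (F (s - v) - F (t - v))).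
  rewrite (_ : (fun v => _) = fun v => k v * F (s - v) + -1 * (k v * F (t - v))).
    by apply: cintegrableD => //; apply: cintegrableZ.
  by apply/funext => v; rewrite mulrBr mulN1r.
have GE s : diff_quot G t s = cintegral D (fun v => k v * q s v).
  rewrite cintegral_setD1 //; last exact: cmeasurableM.
  rewrite diff_quotE (_ : G s - G t =
      cintegral E (fun v => k v * (F (s - v) - F (t - v)))); last first.
    rewrite -[- G t]mulN1r /G -cintegralZ // -cintegralD //; last exact: cintegrableZ.
    by apply: eq_cintegral => v _; rewrite [RHS]mulrBr mulN1r.
  rewrite mulrC -cintegralZ //; apply: eq_cintegral => v _.
  by rewrite /q mulrC mulrA.
have convE' : conv a k f' t = cintegral D (fun v => k v * q' v).
  have [mf' _] := admissible_continuous r0 ab cf' tab'.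
  rewrite (conv_reflect kk mf'); apply: cintegral_extend => [v|v|v Dv nv].
  - move=> /=; rewrite !in_itv /= => /andP[v0 vt]; split.
      by rewrite /E /= in_itv /= v0 /L; lra.
    by move=> /= e; rewrite e ltxx in vt.
  - by rewrite inE /= in_itv /= /q' => /andP[_ ->].
  - have [/EP[v0 _] _] := Dv.
    rewrite /q'; case: ifP => [vt|]; last by rewrite mulr0.
    by exfalso; apply: nv; rewrite /= in_itv /= v0.
apply: within_seq_cvg_complex => s_ sab snt st.
rewrite (_ : (fun n => _) = fun n => cintegral D (fun v => k v * q (s_ n) v));
  last by apply/funext => n; exact: GE.
rewrite convE'; have [C C0 leC] := kk.2 L.
apply: (@cintegral_cvg_dominated _ _ (fun n v => k v * q (s_ n) v)
  (fun v => k v * q' v) (fun v => (C * M) * v `^ (r - 1))) => //.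
- by move=> n; apply: (cmeasurableS mE DE); exact: cmeasurableM.
- move=> v [/EP[v0 vL] vt]; apply: cvg_complexZ.
  have cs : (s_ n - v) @[n --> \oo] --> t - v.
    by apply: cvgB => //; exact: cvg_cst.
  rewrite /q'; case: ifPn => [vta|].
    have tv : t - v \in `]a, b[ by rewrite in_itv /=; apply/andP; split; lra.
    have ev : \forall n \near \oo, s_ n - v \in `]a, b[.
      exact: (cs _ (near_in_itvoo tv)).
    have cw : (s_ n - v) @[n --> \oo] --> within `[a, b] (t - v)^'.
      move=> P /= HP; have ev2 := cs _ HP.
      apply: filterS2 ev ev2 => n nab /=; apply.
        by rewrite (can_eq (subrK v)) snt.
      exact: subset_itv_oo_cc.
    have := cvg_comp _ _ cw (cderiv_wderiv a b (df _ tv)).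
    apply: cvg_trans; apply: near_eq_cvg; apply: filterS ev => n nab.
    rewrite /= diff_quotE /q !F_id; [|exact: subset_itv_oo_cc..].
    by rewrite !opprB !addrA !subrK.
  rewrite -leNgt le_eqVlt => /orP[/eqP e|vta]; first by exfalso; apply: vt.
  apply: cvg_near_cst.
  have : \forall n \near \oo, s_ n - v < a.
    have tva : t - v < a by lra.
    exact: (cs _ (lt_nbhsl tva)).
  apply: filterS => n nva; rewrite /q !F_le ?subrr ?mul0r //; lra.
- apply: (@integrableS _ _ _ mu E D) => //.
  by apply: integrable_scale => //; exact: integrable_powR_oo.
- move=> n v [/EP[v0 vL] _].
  apply: le_trans (norm1M _ _) _; rewrite mulrAC.
  by apply: ler_pM; rewrite ?norm1_ge0 ?leq ?leC // ltW.
Qed.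

(** [int_a^t k(t - u) f(u) du] is the sum of [f a] times a primitive of [k] and
    of the integral [G], in which the variable [t] occurs in [f] only: the
    possibly singular kernel is never differentiated. *)
Lemma conv_wderiv (t : R) : t \in `]a, b] ->
  wderiv a b (conv a k f) t (f a * k (t - a) + conv a k f' t).
Proof.
move=> tab; apply: (@eq_wderiv _ a b
  (fun s => f a * cintegral `]0, s - a[ k + G s)) => //.
  by move=> s sab; rewrite conv_split //; exact: subset_itv_oc_cc.
apply: wderivD; last exact: G_wderiv.
apply: wderivZ; apply: cderiv_wderiv.
have p : is_derive t (1 : R) (fun s : R => s - a) 1.
  exact: (is_derive_ext (@is_derive_shift R t 1 (- a))).
have t0 : 0 < t - a by move: tab; rewrite in_itv /= subr_gt0 => /andP[].
have := @cderiv_comp _ (fun s => s - a) _ t _ _ (kernel_primitive r0 kk t0) p.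
by rewrite mulr1.
Qed.

End ConvolutionDerivative.

(** * Derivative of a convolution, on the side of the kernel *)

Section WithinPoints.
Variables (R : realType) (a b : R).
Hypothesis ab : a < b.
Implicit Types (g : R -> R[i]^o).

Lemma within_continuous_interior g u : {within `[a, b], continuous g} ->
  u \in `]a, b[ -> g w @[w --> u] --> g u.
Proof.
move=> /within_continuous_ReIm[c1 c2] uab.
have [h1 _ _] := (continuous_within_itvP (fun u => complex.Re (g u)) ab).1 c1.
have [h2 _ _] := (continuous_within_itvP (fun u => complex.Im (g u)) ab).1 c2.
by apply/cvg_complexP; split; [exact: h1|exact: h2].
Qed.

Lemma within_continuous_left_seq g (x_ : nat -> R) :
  {within `[a, b], continuous g} -> (forall n, a < x_ n) ->
  x_ n @[n --> \oo] --> a -> g (x_ n) @[n --> \oo] --> g a.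
Proof.
move=> /within_continuous_ReIm[c1 c2] ax xa.
have [_ h1 _] := (continuous_within_itvP (fun u => complex.Re (g u)) ab).1 c1.
have [_ h2 _] := (continuous_within_itvP (fun u => complex.Im (g u)) ab).1 c2.
apply/cvg_complexP; split.
  exact: ((cvg_at_rightP _ _ _).1 h1 x_ (conj ax xa)).
exact: ((cvg_at_rightP _ _ _).1 h2 x_ (conj ax xa)).
Qed.

End WithinPoints.

Section SmoothKernel.
Variables (R : realType) (a b : R).
Hypothesis ab : a < b.
Implicit Types (r t : R) (k f : R -> R[i]^o).

Lemma kernel_weaken r (s : R) k : 0 <= s -> kernel (r + s) k -> kernel r k.
Proof.
move=> s0 [ck bk]; split => // L; have [C C0 leC] := bk L.
exists (C * `|L| `^ s) => [|x x0 xL]; first by rewrite mulr_ge0 ?powR_ge0.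
apply: le_trans (leC x x0 xL) _; rewrite -mulrA ler_wpM2l //.
rewrite (_ : r + s - 1 = s + (r - 1)); last by ring.
rewrite powRD; last by rewrite (gt_eqF x0) implybT.
rewrite ler_wpM2r ?powR_ge0 // ge0_ler_powR ?nnegrE ?(ltW x0) //.
by rewrite (le_trans xL) // ler_norm.
Qed.

(** Integrate the derivative of [s (t - u) f u] over ]a, t[. There is no boundary
    term at [u = t] because [s] vanishes at the origin. *)
Lemma conv_by_parts r (s s' f f' : R -> R[i]^o) t : 0 < r ->
  kernel (r + 1) s -> kernel r s' -> (forall x, 0 < x -> cderiv s x (s' x)) ->
  C1_on a b f f' -> t \in `]a, b] ->
  conv a s' f t = f a * s (t - a) + conv a s f' t.
Proof.
move=> r0 ks ks' ds [df cf cf'] tab.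
have tab' : t \in `[a, b] by exact: subset_itv_oc_cc.
move: (tab); rewrite in_itv /= => /andP[at_ tb].
have ta0 : 0 < t - a by rewrite subr_gt0.
have mI := itv_oo_measurable a t.
have af := admissible_continuous r0 ab cf tab'.
have af' := admissible_continuous r0 ab cf' tab'.
have ks1 := kernel_weaken ler01 ks.
have i1 := conv_cintegrable ks' af; have i2 := conv_cintegrable ks1 af'.
pose h u : R[i]^o := s (t - u) * f u.
pose h' u : R[i]^o := -1 * (s' (t - u) * f u) + s (t - u) * f' u.
have inab u : a < u -> u < t -> u \in `]a, b[.
  by move=> au ut; rewrite in_itv /= au (lt_le_trans ut).
(* With [n + 3] the segments [[a + e n, t - e n]] are never degenerate. *)
pose e n : R := (t - a) / n.+3%:R.
have e0 n : 0 < e n by rewrite divr_gt0 // ltr0n.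
have e_lt n : e n + e n < t - a.
  have : e n <= (t - a) / 3.
    by rewrite /e ler_pM2l // lef_pV2 ?posrE ?ltr0n // ler_nat.
  lra.
have e_cvg : e n @[n --> \oo] --> 0.
  have h0 := @cvg_harmonic R.
  rewrite -(cvg_shiftS (@harmonic R)) -(cvg_shiftS (fun n => @harmonic R n.+1)) in h0.
  have := cvgM (cvg_cst (t - a)) h0.
  by rewrite mulr0; apply.
have : cintegral `]a, t[ h' = - (f a * s (t - a)).
  apply: (@cintegral_exhaustion _ _ h h' (fun n => a + e n) (fun n => t - e n)) => //.
  - by move=> n; have := e_lt n; lra.
  - move=> n u /=; rewrite !in_itv /= => /andP[h1 h2]; have := e0 n.
    by move=> en; apply/andP; split; lra.
  - move=> u /=; rewrite in_itv /= => /andP[au ut].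
    have m0 : 0 < Num.min (u - a) (t - u) by rewrite lt_min !subr_gt0 au.
    have /cvgrPdist_lt/(_ _ m0) := e_cvg; apply: filterS => n.
    rewrite sub0r normrN gtr0_norm // lt_min => /andP[h1 h2].
    by rewrite in_itv /=; apply/andP; split; lra.
  - move=> u /=; rewrite in_itv /= => /andP[au ut].
    have tu : 0 < t - u by rewrite subr_gt0.
    have p : is_derive u (1 : R) (fun w : R => t - w) (-1).
      apply: (is_derive_ext (is_deriveN (@is_derive_shift R u 1 (- t)))) => // w.
      by rewrite fctE /= opprB.
    apply: (cderiv_eq (cderivM (@cderiv_comp _ (fun w => t - w) _ u _ _ (ds _ tu) p)
      (df u (inab u au ut)))).
    by rewrite /h'; congr (_ + _); rewrite rmorphN rmorph1 mulrN1 !mulNr mul1r.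
  - move=> u /=; rewrite in_itv /= => /andP[au ut].
    have tu : 0 < t - u by rewrite subr_gt0.
    have c : (t - w) @[w --> u] --> t - u.
      by apply: cvgB; [exact: cvg_cst|exact: cvg_id].
    have c1 := cvg_comp _ _ c (ks'.1 _ tu); have c2 := cvg_comp _ _ c (ks.1 _ tu).
    have c3 := within_continuous_interior ab cf (inab u au ut).
    have c4 := within_continuous_interior ab cf' (inab u au ut).
    exact: (cvg_complexD (cvg_complexZ (z := -1) (cvg_complexM c1 c3))
      (cvg_complexM c2 c4)).
  - by apply: cintegrableD => //; exact: cintegrableZ.
  - rewrite -[X in _ --> X]add0r -mulN1r; apply: cvg_complexD.
      have [M M0 leM] := within_continuous_bounded (ltW ab) cf.
      have [C C0 leC] := ks.2 (t - a).
      apply: (@norm1_squeeze _ _ _ _ _ _ (fun n => C * (e n) `^ r * M)).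
        apply: nearW => n; rewrite sub0r norm1N /h subKr.
        apply: le_trans (norm1M _ _) _; apply: ler_pM; rewrite ?norm1_ge0 //.
          have := leC (e n) (e0 n); rewrite addrK; apply.
          by have := e_lt n; have := e0 n; lra.
        apply: leM; rewrite in_itv /=; have := e_lt n; have := e0 n.
        by move=> ? ?; apply/andP; split; lra.
      have er : (e n) `^ r @[n --> \oo] --> (0 : R).
        exact: ((cvg_at_rightP _ _ _).1 (powR_cvg0 r0) e (conj e0 e_cvg)).
      have := cvgM (cvgM (cvg_cst C) er) (cvg_cst M).
      by rewrite mulr0 mul0r; apply.
    rewrite (_ : (fun n => _) = fun n => -1 * h (a + e n)); last first.
      by apply/funext => n; rewrite mulN1r.
    apply: cvg_complexZ; rewrite [f a * _]mulrC; apply: cvg_complexM.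
      have c : (t - (a + e n)) @[n --> \oo] --> t - a.
        rewrite -[X in _ --> X]subr0 (_ : (fun n => _) = fun n => t - a - e n).
          by apply: cvgB => //; exact: cvg_cst.
        by apply/funext => n; ring.
      exact: (cvg_comp _ _ c (ks.1 _ ta0)).
    apply: (within_continuous_left_seq ab cf) => [n|]; first by rewrite ltrDl.
    rewrite -[X in _ --> X]addr0; apply: cvgD => //; exact: cvg_cst.
rewrite /h' cintegralD //; last exact: cintegrableZ.
rewrite cintegralZ // -(convE ks' af.1) -(convE ks1 af'.1) mulN1r => E.
by rewrite -(opprK (f a * _)) -E opprD opprK addrNK.
Qed.

(** A kernel that vanishes at the origin may be differentiated in place of the
    function: the boundary terms of the two previous results cancel. *)
Lemma conv_wderiv_kernel r (s s' f f' : R -> R[i]^o) t : 0 < r ->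
  kernel (r + 1) s -> kernel r s' -> (forall x, 0 < x -> cderiv s x (s' x)) ->
  C1_on a b f f' -> t \in `]a, b] -> wderiv a b (conv a s f) t (conv a s' f t).
Proof.
move=> r0 ks ks' ds ff' tab; rewrite (conv_by_parts r0 ks ks' ds ff' tab).
exact: (conv_wderiv ab r0 (kernel_weaken ler01 ks) ff' tab).
Qed.

End SmoothKernel.

(** * Expansion of the tempered kernels *)

Section TemperedKernels.
Variable R : realType.
Local Notation mu := (@lebesgue_measure R).
Implicit Types (a t x : R) (f : R -> R[i]^o) (z nu beta : R[i]) (k m n : nat).

Lemma kernel_cpow z : kernel (complex.Re z + 1) (fun x => cpow x z).
Proof.
split=> [x x0|L]; first exact: cderiv_cvg (cderiv_cpow z x0).
by exists 2 => // x x0 _; rewrite addrK; exact: norm1_cpow.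
Qed.

Lemma norm1_cpow_exp_rem z beta k x : 0 <= complex.Re beta -> 0 < x ->
  norm1 (cpow x z * exp_rem beta k x) <=
  4 * (2 * norm1 beta) ^+ k / k`!%:R * x `^ (complex.Re z + k%:R).
Proof.
move=> b0 x0; apply: le_trans (norm1M _ _) _.
have h1 := norm1_cpow z x0; have h2 := norm1_exp_rem k b0 (ltW x0).
apply: le_trans (ler_pM (norm1_ge0 _) (norm1_ge0 _) h1 h2) _.
rewrite powRD; last by rewrite (gt_eqF x0) implybT.
rewrite powR_mulrn ?(ltW x0) // le_eqVlt; apply/orP; left; apply/eqP.
by ring.
Qed.

Lemma kernel_cpow_exp_rem z beta k : 0 <= complex.Re beta ->
  kernel (complex.Re z + k%:R + 1) (fun x => cpow x z * exp_rem beta k x).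
Proof.
move=> b0; split=> [x x0|L].
  exact: cderiv_cvg (cderivM (cderiv_cpow z x0) (cderiv_exp_rem beta k x)).
exists (4 * (2 * norm1 beta) ^+ k / k`!%:R) => [|x x0 _].
  by rewrite divr_ge0 // mulr_ge0 // exprn_ge0 // mulr_ge0 // norm1_ge0.
by rewrite addrK; exact: norm1_cpow_exp_rem.
Qed.

(** Applying [(d/dx + beta) ^ k] to the kernel [x ^ (nu - 1) e ^ (- beta x)] of
    the tempered integral gives [(nu - k)_k x ^ (nu - k - 1) e ^ (- beta x)], which
    is not integrable at the origin for large [k]. Replacing the exponential by
    its remainder of order [k] removes the nonintegrable terms. *)
Definition tempered_kernel nu beta k x : R[i]^o :=
  cpow x (nu - k%:R - 1) * exp_rem beta k x.

Lemma kernel_cpow_order nu : kernel (complex.Re nu) (fun x => cpow x (nu - 1)).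
Proof. by have := kernel_cpow (nu - 1); rewrite ReD ReN /= subrK. Qed.

(** A remainder of order [k + n] gains [k + n] powers of [x] and the exponent
    loses [k]. *)
Lemma kernel_tempered nu beta k n : 0 <= complex.Re beta ->
  kernel (complex.Re nu + n%:R)
    (fun x => cpow x (nu - k%:R - 1) * exp_rem beta (k + n) x).
Proof.
move=> b0; have := kernel_cpow_exp_rem (nu - k%:R - 1) (k + n) b0.
rewrite !ReD !ReN Re_nat /= natrD.
by rewrite (_ : _ + 1 = complex.Re nu + n%:R) //; ring.
Qed.

Lemma kernel_tempered0 nu beta k n : 0 <= complex.Re beta ->
  kernel (complex.Re nu)
    (fun x => cpow x (nu - k%:R - 1) * exp_rem beta (k + n) x).
Proof. by move=> b0; exact: kernel_weaken (ler0n _ n) (kernel_tempered _ _ _ b0). Qed.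

Lemma cpow_exp_remS nu beta k n x : 0 < x ->
  cpow x (nu - k%:R - 1) * exp_rem beta (k + n) x =
  cpow x (nu - k%:R - 1) * exp_rem beta (k + n.+1) x +
  (- beta) ^+ (k + n) / (k + n)`!%:R * cpow x (nu + n%:R - 1).
Proof.
move=> x0; rewrite addnS exp_remS.
have -> : cpow x (nu + n%:R - 1) =
    cpow x (nu - k%:R - 1) * (x ^+ (k + n))%:C.
  by rewrite -(cpow_nat _ x0) -cpowD; congr cpow; rewrite natrD; ring.
by move: (cpow _ _) (exp_rem _ _ _) => c e; rewrite mulrBr [in RHS]mulrCA subrK.
Qed.

Lemma conv_tempered_split nu beta k n f a t : 0 < complex.Re nu ->
  0 <= complex.Re beta -> admissible (complex.Re nu) f a t ->
  conv a (tempered_kernel nu beta k) f t =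
  \sum_(m < n) (- beta) ^+ (k + m) / (k + m)`!%:R *
    conv a (fun x => cpow x (nu + m%:R - 1)) f t +
  conv a (fun x => cpow x (nu - k%:R - 1) * exp_rem beta (k + n) x) f t.
Proof.
move=> nu0 b0 af; have [mf _] := af.
elim: n => [|n IH].
  by rewrite big_ord0 add0r addn0.
rewrite IH big_ord_recr /= -[RHS]addrA; congr (_ + _).
have kn : kernel (complex.Re nu) (fun x => cpow x (nu + n%:R - 1)).
  have := kernel_cpow_order (nu + n%:R); rewrite ReD Re_nat.
  exact: kernel_weaken.
have kS := kernel_tempered0 nu k n.+1 b0.
have kZ := kernelZ ((- beta) ^+ (k + n) / (k + n)`!%:R) kn.
rewrite (eq_conv (kernel_tempered0 nu k n b0) (kernelD kS kZ) mf); last first.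
  by move=> x x0; exact: cpow_exp_remS.
by rewrite (convD kS kZ af) (convZ _ kn af) [LHS]addrC.
Qed.

(** After [n] terms the kernel of the error is a multiple of a remainder of order
    [k + n], hence at most [c n] times the dominating kernel [x ^ (nu - 1)], where
    [c n] tends to [0] like the terms of an exponential series. Only the absolute
    convergence of one integral at the point [t] is used, so the same statement
    serves continuous and merely integrable [f]. *)
Lemma conv_tempered_expansion nu beta k f a t : 0 < complex.Re nu ->
  0 <= complex.Re beta -> admissible (complex.Re nu) f a t ->
  \sum_(m < n) (- beta) ^+ (k + m) / (k + m)`!%:R *
    conv a (fun x => cpow x (nu + m%:R - 1)) f t @[n --> \oo] -->
  conv a (tempered_kernel nu beta k) f t.
Proof.
move=> nu0 b0 af; have [mf jf] := af.
have mI := itv_oo_measurable a t.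
set J := Rintegral mu `]a, t[
  (fun u => (t - u) `^ (complex.Re nu - 1) * norm1 (f u)).
pose c n : R := 4 * (2 * norm1 beta) ^+ (k + n) / (k + n)`!%:R * `|t - a| ^+ n.
have J0 : 0 <= J.
  by apply: Rintegral_ge0 => u _; rewrite mulr_ge0 ?powR_ge0 ?norm1_ge0.
have c0 n : 0 <= c n.
  rewrite mulr_ge0 ?exprn_ge0 // divr_ge0 // mulr_ge0 // exprn_ge0 //.
  by rewrite mulr_ge0 // norm1_ge0.
apply: (@norm1_squeeze _ _ _ _ _ _ (fun n => 2 * (c n * J))).
  apply: nearW => n; rewrite (conv_tempered_split k n nu0 b0 af) addrC addKr.
  have kn := kernel_tempered0 nu k n b0.
  rewrite (convE kn mf).
  have := norm1_cintegral_le mI (conv_cmeasurable kn mf) (integrable_scale (c n) mI jf).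
  rewrite RintegralZl //; apply => u /=; rewrite in_itv /= => /andP[au ut].
  have tu : 0 < t - u by rewrite subr_gt0.
  apply: le_trans (norm1M _ _) _; rewrite mulrA ler_wpM2r ?norm1_ge0 //.
  apply: le_trans (norm1_cpow_exp_rem _ _ b0 tu) _.
  rewrite /c -[X in _ <= X]mulrA ler_wpM2l //.
    rewrite divr_ge0 // mulr_ge0 // exprn_ge0 //.
    by rewrite mulr_ge0 // norm1_ge0.
  rewrite !ReD !ReN Re_nat /=.
  rewrite (_ : _ + (k + n)%:R = n%:R + (complex.Re nu - 1)); last first.
    by rewrite natrD; ring.
  rewrite [leLHS]powRD; last by rewrite (gt_eqF tu) implybT.
  rewrite powR_mulrn ?(ltW tu) // ler_wpM2r ?powR_ge0 // lerXn2r ?nnegrE ?(ltW tu) //.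
  by apply: le_trans (ler_norm _); rewrite lerD2l lerN2 ltW.
have cc : c n @[n --> \oo] --> 0.
  pose y := 2 * norm1 beta * `|t - a|.
  apply: (@squeeze_cvgr _ _ _ _ (fun=> 0)
    (fun n => 4 * (2 * norm1 beta) ^+ k * exp_coeff y n)).
  - apply: nearW => n; rewrite c0 /=.
    have -> : exp_coeff y n = y ^+ n / n`!%:R by [].
    rewrite /c /y exprD [(_ * `|t - a|) ^+ n]exprMn.
    rewrite [leLHS](_ : _ = 4 * (2 * norm1 beta) ^+ k *
      ((2 * norm1 beta) ^+ n * `|t - a| ^+ n / (k + n)`!%:R)); last by ring.
    rewrite ler_wpM2l //.
      by rewrite mulr_ge0 // exprn_ge0 // mulr_ge0 // norm1_ge0.
    rewrite ler_wpM2l //.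
      by rewrite mulr_ge0 ?exprn_ge0 // mulr_ge0 // norm1_ge0.
    by rewrite lef_pV2 ?posrE ?ltr0n ?fact_gt0 // ler_nat leq_fact // leq_addl.
  - exact: cvg_cst.
  - have := cvgM (cvg_cst (4 * (2 * norm1 beta) ^+ k)) (cvg_exp_coeff y).
    by rewrite mulr0; apply.
have := cvgM (cvg_cst (2 : R)) (cvgM cc (cvg_cst J)).
by rewrite mul0r mulr0; apply.
Qed.

End TemperedKernels.

(** * Repeated derivatives of fractional integrals *)

Section SmoothFunctions.
Variables (R : realType) (a b : R).
Hypothesis ab : a < b.
Implicit Types (t : R) (f g h : R -> R[i]^o) (z nu : R[i]).

(** Repeated differentiability on ]a, b]; nothing is asked at [a], where the
    fractional integrals below may have unbounded derivatives. *)
Fixpoint smooth n g : Prop :=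
  if n is n'.+1 then
    exists g', (forall t, t \in `]a, b] -> wderiv a b g t (g' t)) /\ smooth n' g'
  else True.

Lemma eq_smooth n g h : {in `]a, b], g =1 h} -> smooth n g -> smooth n h.
Proof.
case: n => [//|n] gh [g' [dg sg]]; exists g'; split => // t tab.
exact: eq_wderiv tab gh (dg t tab).
Qed.

Lemma smoothD n g h : smooth n g -> smooth n h -> smooth n (fun t => g t + h t).
Proof.
elim: n g h => [//|n IH] g h [g' [dg sg]] [h' [dh sh]].
exists (fun t => g' t + h' t); split; last exact: IH.
by move=> t tab; apply: wderivD; [exact: dg|exact: dh].
Qed.

Lemma smoothZ n z g : smooth n g -> smooth n (fun t => z * g t).
Proof.
elim: n g => [//|n IH] g [g' [dg sg]].
exists (fun t => z * g' t); split; last exact: IH.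
by move=> t tab; apply: wderivZ; exact: dg.
Qed.

(** The iterates of [deriv_on] take the derivatives given by [smooth]; at [a] they
    may be meaningless, which does not affect their values on ]a, b]. *)
Lemma smooth_iter n g j t : smooth n g -> (j < n)%N -> t \in `]a, b] ->
  wderiv a b (iter j (deriv_on a b) g) t (iter j.+1 (deriv_on a b) g t).
Proof.
elim: n g j => [//|n IH] g j [g' [dg sg]] jn tab.
have dE : {in `]a, b], g' =1 deriv_on a b g}.
  move=> s sab; apply/esym; apply: (wderiv_deriv_on ab); last exact: dg.
  exact: subset_itv_oc_cc.
case: j jn => [|j] jn.
  by rewrite /= -dE //; exact: dg.
rewrite iterSr [in X in wderiv _ _ _ _ X]iterSr; apply: IH => //.
exact: eq_smooth dE sg.
Qed.

Lemma wderiv_cpow_shift z t : a < t ->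
  wderiv a b (fun s => cpow (s - a) z) t (z * cpow (t - a) (z - 1)).
Proof.
move=> at_; apply: cderiv_wderiv.
have p : is_derive t (1 : R) (fun s : R => s - a) 1.
  exact: (is_derive_ext (@is_derive_shift R t 1 (- a))).
have t0 : 0 < t - a by rewrite subr_gt0.
apply: (cderiv_eq (@cderiv_comp _ (fun s => s - a) (fun x => cpow x z) t _ _
  (cderiv_cpow z t0) p)).
by rewrite mulr1.
Qed.

Lemma smooth_cpow n z : smooth n (fun t => cpow (t - a) z).
Proof.
elim: n z => [//|n IH] z; exists (fun t => z * cpow (t - a) (z - 1)); split.
  by move=> t; rewrite in_itv /= => /andP[at_ _]; exact: wderiv_cpow_shift.
exact/smoothZ/IH.
Qed.

Lemma Cn_on_C1_on n f : Cn_on n.+1 a b f -> C1_on a b f (deriv_on a b f).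
Proof.
move=> [df cf]; split; [|exact: (cf 0%N)|exact: (cf 1%N)].
move=> u uab; apply: (wderiv_cderiv uab); apply: derivable_on_wderiv.
by apply: (df 0%N) => //; exact: subset_itv_oo_cc.
Qed.

Lemma Cn_on_deriv n f : Cn_on n.+1 a b f -> Cn_on n a b (deriv_on a b f).
Proof.
move=> [df cf]; split=> [k t kn tab|k kn]; rewrite -iterSr.
  exact: df.
exact: cf.
Qed.

(** Differentiating the integral reproduces an integral of the same order for
    [f'], plus a multiple of [(t - a) ^ (nu - 1)], which is smooth away from
    [a]. *)
Lemma smooth_conv_cpow n nu f : 0 < complex.Re nu -> Cn_on n a b f ->
  smooth n (conv a (fun x => cpow x (nu - 1)) f).
Proof.
move=> nu0; elim: n f => [//|n IH] f cf.
have c1 := Cn_on_C1_on cf; have cf' := Cn_on_deriv cf.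
exists (fun t => f a * cpow (t - a) (nu - 1) +
   conv a (fun x => cpow x (nu - 1)) (deriv_on a b f) t); split.
  by move=> t tab; apply: (conv_wderiv ab nu0 (kernel_cpow_order nu) c1 tab).
by apply: smoothD; [apply/smoothZ/smooth_cpow|exact: IH].
Qed.

Lemma wderiv_sum n (h : nat -> R -> R[i]^o) (d : nat -> R[i]^o) t :
  (forall m, (m < n)%N -> wderiv a b (h m) t (d m)) ->
  wderiv a b (fun s => \sum_(m < n) h m s) t (\sum_(m < n) d m).
Proof.
elim: n => [|n IH] H.
  rewrite big_ord0 (_ : (fun _ => _) = fun=> 0 : R[i]^o); last first.
    by apply/funext => s; rewrite big_ord0.
  exact/cderiv_wderiv/cderiv_cst.
rewrite big_ord_recr /=.
rewrite (_ : (fun _ => _) = fun s => \sum_(m < n) h m s + h n s); last first.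
  by apply/funext => s; rewrite big_ord_recr.
by apply: wderivD; [apply: IH => m mn; apply: H; exact: ltnW|exact: H].
Qed.

(** One step of [d/dx + beta] on the tempered kernels. The most singular term
    [x ^ (nu - 1)] of the kernel is split off; what remains vanishes at the
    origin and is differentiated as a kernel. *)
Lemma wderiv_conv_tempered nu beta k f f' t d : 0 < complex.Re nu ->
  0 <= complex.Re beta -> C1_on a b f f' -> t \in `]a, b] ->
  wderiv a b (conv a (fun x => cpow x (nu - 1)) f) t d ->
  wderiv a b (conv a (tempered_kernel nu beta k) f) t
   ((nu - k%:R - 1) * conv a (tempered_kernel nu beta k.+1) f t
    - beta * conv a (tempered_kernel nu beta k) f t
    + (- beta) ^+ k / k`!%:R * d).
Proof.
move=> nu0 b0 ff' tab hd; have [_ cf _] := ff'.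
have adm s : s \in `]a, b] -> admissible (complex.Re nu) f a s.
  by move=> /subset_itv_oc_cc sab; exact: admissible_continuous cf sab.
pose sigma x : R[i]^o := cpow x (nu - k%:R - 1) * exp_rem beta (k + 1) x.
have krho j : kernel (complex.Re nu) (tempered_kernel nu beta j).
  by have := kernel_tempered0 nu j 0 b0; rewrite addn0.
have ksigma : kernel (complex.Re nu + 1) sigma by exact: kernel_tempered.
have k0 := kernel_cpow_order nu.
pose sigma' x : R[i]^o := (nu - k%:R - 1) * tempered_kernel nu beta k.+1 x +
  (- beta) * tempered_kernel nu beta k x.
have ksigma' : kernel (complex.Re nu) sigma'.
  by apply: kernelD; apply: kernelZ; exact: krho.
have dsigma x : 0 < x -> cderiv sigma x (sigma' x).
  move=> x0; rewrite /sigma addn1.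
  apply: (cderiv_eq (cderivM (cderiv_cpow (nu - k%:R - 1) x0)
    (cderiv_exp_rem beta k.+1 x))).
  rewrite /sigma' /tempered_kernel /= (_ : nu - k.+1%:R - 1 = nu - k%:R - 1 - 1).
    move: (cpow _ _) (cpow _ _) (exp_rem _ _ _) (exp_rem _ _ _) => c c' e e'.
    by rewrite -mulrA; congr (_ + _); rewrite mulrCA.
  by rewrite -natr1 opprD addrA.
have hs := conv_wderiv_kernel ab nu0 ksigma ksigma' dsigma ff' tab.
have ks := kernel_weaken ler01 ksigma.
have kz := kernelZ ((- beta) ^+ k / k`!%:R) k0.
have E : {in `]a, b], (fun s => conv a sigma f s +
    (- beta) ^+ k / k`!%:R * conv a (fun x => cpow x (nu - 1)) f s) =1
    conv a (tempered_kernel nu beta k) f}.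
  move=> s sab; have af := adm s sab; have [mf _] := af.
  rewrite -(convZ _ k0 af) -(convD ks kz af).
  apply: (eq_conv (kernelD ks kz) (krho k) mf) => x x0.
  have := cpow_exp_remS nu beta k 0 x0; rewrite !addn0 addr0 /tempered_kernel.
  by move=> ->.
apply: (eq_wderiv tab E).
have af := adm t tab.
have -> : (nu - k%:R - 1) * conv a (tempered_kernel nu beta k.+1) f t
    - beta * conv a (tempered_kernel nu beta k) f t = conv a sigma' f t.
  rewrite (convD (kernelZ _ (krho k.+1)) (kernelZ _ (krho k)) af).
  by rewrite (convZ _ (krho _) af) (convZ _ (krho _) af) mulNr.
by apply: wderivD => //; exact: wderivZ.
Qed.

End SmoothFunctions.

(** * The series of the tempered derivative *)

Section Pochhammer.
Variable R : realType.
Implicit Types (z : R[i]).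

Lemma pochhammer0 z : pochhammer z 0 = 1.
Proof. by rewrite /pochhammer big_ord0. Qed.

Lemma pochhammerSr z m : pochhammer z m.+1 = pochhammer z m * (z + m%:R).
Proof. by rewrite /pochhammer big_ord_recr. Qed.

Lemma pochhammerS z m : pochhammer z m.+1 = z * pochhammer (z + 1) m.
Proof.
rewrite /pochhammer big_ord_recl /= addr0; congr (_ * _).
by apply: eq_bigr => i _; rewrite -natr1 [i%:R + 1]addrC addrA.
Qed.

Lemma pochhammer_add z m n :
  pochhammer z (m + n) = pochhammer z m * pochhammer (z + m%:R) n.
Proof.
elim: n => [|n IH]; first by rewrite addn0 pochhammer0 mulr1.
by rewrite addnS !pochhammerSr IH natrD -mulrA addrA.
Qed.

Lemma pochhammer_neq0 z m : 0 < complex.Re z -> pochhammer z m != 0.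
Proof.
move=> z0; rewrite prodf_seq_neq0; apply/allP => i _ /=.
apply/eqP => /(congr1 (@complex.Re R)); rewrite ReD Re_nat /= => e.
by have := ltr_wpDr (ler0n R i) z0; rewrite e ltxx.
Qed.

Definition tempered_coef (beta z : R[i]) m : R[i]^o :=
  (- beta) ^+ m * pochhammer z m / m`!%:R.

Lemma tempered_coef0 beta z : tempered_coef beta z 0 = 1.
Proof. by rewrite /tempered_coef expr0 pochhammer0 fact0 divr1 mulr1. Qed.

(** A Pascal-type rule. If [L] is a sequence of functions with
    [L (m + 1)' = L m], then [d/dx + beta] maps the series of terms
    [tempered_coef beta z m * L m] to the one with [z - 1] and [L (m - 1)]. *)
Lemma tempered_coefS beta z m :
  tempered_coef beta (z - 1) m.+1 =
  tempered_coef beta z m.+1 + beta * tempered_coef beta z m.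
Proof.
rewrite /tempered_coef pochhammerS subrK pochhammerSr factS natrM exprS -natr1.
have m0 : (m%:R + 1 : R[i]) != 0 by rewrite natr1 pnatr_eq0.
have f0 : (m`!%:R : R[i]) != 0 by rewrite pnatr_eq0 -lt0n fact_gt0.
move: (m%:R : R[i]) (m`!%:R : R[i]) (pochhammer z m : R[i]) m0 f0 => M f P M0 f0.
by field; rewrite M0 f0.
Qed.

End Pochhammer.

Lemma T_integral_conv (R : realType) (a : R) (nu beta : R[i]) f t :
  T_integral a nu beta f t =
  (cGamma nu)^-1 * conv a (tempered_kernel nu beta 0) f t.
Proof.
congr (_ * _); apply: eq_cintegral => u _.
by rewrite /tempered_kernel !subr0 exp_rem0.
Qed.

Section TemperedDerivative.
Variables (R : realType) (a b : R).
Hypothesis ab : a < b.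
Variables (nu beta : R[i]) (f : R -> R[i]^o) (n : nat).
Hypotheses (nu0 : 0 < complex.Re nu) (b0 : 0 <= complex.Re beta).
Hypotheses (n0 : (0 < n)%N) (cf : Cn_on n a b f).

Let c : R[i] := (cGamma nu)^-1.
Let G j : R -> R[i]^o := iter j (deriv_on a b) (RL_integral_pos a nu f).

(** A closed form of [(d/dt + beta) ^ k] of the tempered integral of order [nu]:
    the first [k] terms of the series are derivatives of the Riemann-Liouville
    integral of order [nu], and the sum of all the others is one convolution. *)
Let S k (t : R) : R[i]^o :=
  \sum_(m < k) tempered_coef beta (nu - k%:R) m * G (k - m) t +
  c * pochhammer (nu - k%:R) k * conv a (tempered_kernel nu beta k) f t.

Let G_wderiv j t : (j < n)%N -> t \in `]a, b] -> wderiv a b (G j) t (G j.+1 t).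
Proof.
move=> jn tab; apply: (smooth_iter ab) jn tab.
exact/smoothZ/smooth_conv_cpow.
Qed.

Let C1f : C1_on a b f (deriv_on a b f).
Proof. by case: n n0 cf => // m _; exact: Cn_on_C1_on. Qed.

Let conv_cpow_wderiv t : t \in `]a, b] -> exists d,
  wderiv a b (conv a (fun x => cpow x (nu - 1)) f) t d /\ c * d = G 1 t.
Proof.
move=> tab; have := smooth_conv_cpow ab nu0 cf.
case: n n0 => // m _ [g' [dg _]]; exists (g' t); split; first exact: dg.
apply/esym; apply: (wderiv_deriv_on ab); first exact: subset_itv_oc_cc.
exact/wderivZ/dg.
Qed.

(** The singular part of the kernel contributes the new term in [G 1] of the
    finite sum; the rest is the Pascal-type rule and
    [(nu - k - 1)_(k+1) = (nu - k - 1) (nu - k)_k]. *)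
Let S_wderiv k t : (k < n)%N -> t \in `]a, b] ->
  wderiv a b (S k) t (S k.+1 t - beta * S k t).
Proof.
move=> kn tab; have [d [hd cd]] := conv_cpow_wderiv tab.
set al := tempered_coef beta (nu - k%:R); set P := c * pochhammer (nu - k%:R) k.
have h1 : wderiv a b (fun s => \sum_(m < k) al m * G (k - m) s) t
    (\sum_(m < k) al m * G (k - m).+1 t).
  apply: (@wderiv_sum _ a b k (fun m s => al m * G (k - m) s)
    (fun m => al m * G (k - m).+1 t)) => m mk; apply: wderivZ; apply: G_wderiv => //.
  exact: leq_ltn_trans (leq_subr _ _) kn.
have h2 := wderiv_conv_tempered ab (k := k) nu0 b0 C1f tab hd.
have {h1 h2} := wderivD h1 (wderivZ (z := P) h2).
congr (wderiv _ _ _ _ _).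
have nuS : nu - k.+1%:R = nu - k%:R - 1 by rewrite -natr1 opprD addrA.
have Pd : P * ((- beta) ^+ k / k`!%:R * d) = al k * G 1 t.
  by rewrite -cd /P /al /tempered_coef; ring.
rewrite mulrDr Pd {hd Pd}.
rewrite /S nuS big_ord_recl /= ?subn0 tempered_coef0 mul1r.
under [in RHS]eq_bigr => i _ do rewrite /bump /= add1n subSS tempered_coefS.
rewrite pochhammerS subrK.
rewrite -/al.
have shift : \sum_(m < k) al m * G (k - m).+1 t + al k * G 1 t =
    G k.+1 t + \sum_(i < k) al i.+1 * G (k - i) t.
  transitivity (\sum_(m < k.+1) al m * G (k.+1 - m) t).
    rewrite big_ord_recr /= subSnn; congr (_ + _).
    by apply: eq_bigr => i _; rewrite subSn // ltnW.
  rewrite big_ord_recl subn0 /= {1}/al tempered_coef0 mul1r; congr (_ + _).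
have split : \sum_(i < k) (al i.+1 + beta * al i) * G (k - i) t =
    \sum_(i < k) al i.+1 * G (k - i) t + beta * \sum_(i < k) al i * G (k - i) t.
  rewrite mulr_sumr -big_split; apply: eq_bigr => i _.
  by rewrite mulrDl -[beta * al i * _]mulrA.
rewrite -[deriv_on a b (G k) t]/(G k.+1 t).
rewrite -[deriv_on a b (RL_integral_pos a nu f) t]/(G 1 t).
rewrite split.
move: shift {split}.
move: (\sum_(m < k) al m * G (k - m).+1 t) (al k * G 1 t) (G k.+1 t)
  (\sum_(i < k) al i.+1 * G (k - i) t) (\sum_(i < k) al i * G (k - i) t).
move=> A B C D E shift; rewrite [LHS]addrCA shift.
move: (conv _ _ _ _) (conv _ _ _ _) => X Y.
rewrite /P; move: (pochhammer _ _) => p.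
by ring.
Qed.

Let iter_tempered k t : (k <= n)%N -> t \in `]a, b] ->
  iter k (fun g t => deriv_on a b g t + beta * g t) (T_integral a nu beta f) t =
  S k t.
Proof.
elim: k t => [|k IH] t kn tab.
  by rewrite /= T_integral_conv /S big_ord0 add0r pochhammer0 mulr1.
rewrite iterS IH // ?(ltnW kn) //.
rewrite (wderiv_deriv_on ab (l := S k.+1 t - beta * S k t)) ?subrK //.
  exact: subset_itv_oc_cc.
apply: (eq_wderiv tab _ (S_wderiv kn tab)) => s sab.
by rewrite IH // ltnW.
Qed.

(** Since [(nu - n)_m = (nu - n)_n (nu)_(m-n)], the factor [(nu)_(m-n)] cancels
    against [Gamma(nu + m - n) = (nu)_(m-n) Gamma(nu)]. *)
Let RL_integral_posE m t : (n <= m)%N ->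
  tempered_coef beta (nu - n%:R) m * RL_integral_pos a (nu - n%:R + m%:R) f t =
  c * pochhammer (nu - n%:R) n * ((- beta) ^+ (n + (m - n)) / (n + (m - n))`!%:R *
    conv a (fun x => cpow x (nu + (m - n)%:R - 1)) f t).
Proof.
move=> nm; rewrite subnKC //.
have -> : nu - n%:R + m%:R = nu + (m - n)%:R by rewrite natrB // addrAC addrA.
rewrite /RL_integral_pos -/(conv a (fun x => cpow x (nu + (m - n)%:R - 1)) f t).
rewrite cGamma_pochhammer // invfM -/c /tempered_coef.
have -> : pochhammer (nu - n%:R) m =
    pochhammer (nu - n%:R) n * pochhammer nu (m - n).
  by rewrite -[in LHS](subnKC nm) pochhammer_add subrK.
have := pochhammer_neq0 (m - n) nu0.
have f0 : (m`!%:R : R[i]) != 0 by rewrite pnatr_eq0 -lt0n fact_gt0.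
move: (conv _ _ _ _) (m`!%:R : R[i]) f0 (pochhammer nu (m - n)) (pochhammer _ n).
move=> X F F0 p q p0.
by field; rewrite F0 p0.
Qed.

Let tempered_series t : t \in `]a, b] ->
  (\sum_(m < N) tempered_coef beta (nu - n%:R) m *
     (if (m < n)%N then G (n - m) t
      else RL_integral_pos a (nu - n%:R + m%:R) f t)) @[N --> \oo] --> S n t.
Proof.
move=> tab.
rewrite -(@cvg_shiftn n (R[i]^o)).
set u := fun m : nat => tempered_coef beta (nu - n%:R) m *
     (if (m < n)%N then G (n - m) t
      else RL_integral_pos a (nu - n%:R + m%:R) f t).
have af : admissible (complex.Re nu) f a t.
  apply: (admissible_continuous nu0 ab _ (subset_itv_oc_cc tab)).
  exact: (cf.2 0%N).
rewrite (_ : (fun N => _) = fun N =>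
  \sum_(m < n) tempered_coef beta (nu - n%:R) m * G (n - m) t +
  c * pochhammer (nu - n%:R) n * \sum_(m < N) (- beta) ^+ (n + m) / (n + m)`!%:R *
    conv a (fun x => cpow x (nu + m%:R - 1)) f t).
  apply: cvg_complexD; first exact: cvg_cst.
  by apply: cvg_complexZ; exact: conv_tempered_expansion.
apply/funext => N; rewrite addnC big_split_ord /=; congr (_ + _).
  by apply: eq_bigr => i _; rewrite ltn_ord.
rewrite mulr_sumr; apply: eq_bigr => i _.
by rewrite ltnNge leq_addr /= RL_integral_posE ?leq_addr // addKn.
Qed.

(** For [k = n] the closed form is the sum of the announced series: its finite
    sum is made of the first [n] terms, and its convolution expands into the
    others. *)
Lemma tempered_derivative_series t : t \in `]a, b] ->
  (\sum_(m < N) tempered_coef beta (nu - n%:R) m *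
     (if (m < n)%N then iter (n - m) (deriv_on a b) (RL_integral_pos a nu f) t
      else RL_integral_pos a (nu - n%:R + m%:R) f t)) @[N --> \oo] -->
  iter n (fun g t => deriv_on a b g t + beta * g t) (T_integral a nu beta f) t.
Proof. by move=> tab; rewrite iter_tempered //; exact: tempered_series. Qed.

End TemperedDerivative.

(** * The order of a fractional derivative *)

Section FracOrder.
Variable R : realType.
Implicit Types (z : R[i]).

Lemma frac_order_bounds z : 0 <= complex.Re z ->
  (frac_order z).-1%:R <= complex.Re z < (frac_order z)%:R.
Proof.
move=> z0; rewrite /frac_order /=.
have f0 : 0 <= Num.floor (complex.Re z) by rewrite floor_ge0.
have E : (`|Num.floor (complex.Re z)|%N)%:R = (Num.floor (complex.Re z))%:~R :> R.
  by rewrite -{2}(gez0_abs f0).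
apply/andP; split; first by rewrite E floor_le.
by rewrite -natr1 E; have := floorD1_gt (complex.Re z); rewrite intrD.
Qed.

Lemma frac_order_eq z n : (0 < n)%N -> n.-1%:R <= complex.Re z < n%:R ->
  frac_order z = n.
Proof.
case: n => // j _ h; rewrite /frac_order (@floor_def _ _ j%:Z) //.
by rewrite -[X in _ < X]/((j%:Z + 1)%:~R) intrD natr1.
Qed.

End FracOrder.

Lemma T_derivative_series (R : realType) (a b : R) (alpha beta : R[i])
    (f : R -> R[i]^o) (t : R) : a < b ->
  0 <= complex.Re alpha -> 0 <= complex.Re beta ->
  Cn_on (frac_order alpha) a b f -> t \in `]a, b] ->
  series (fun m : nat =>
    (- beta) ^+ m * pochhammer (- alpha) m / m`!%:R
    * RL_integral a b (- alpha + m%:R) f t) @ \oo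
  --> T_derivative a b alpha beta f t.
Proof.
move=> ab al0 be0 cf tab.
set n := frac_order alpha in cf *; pose nu : R[i] := n%:R - alpha.
have /andP[nal aln] := frac_order_bounds al0.
have nu0 : 0 < complex.Re nu by rewrite /nu ReD ReN Re_nat subr_gt0.
have nuE : nu - n%:R = - alpha by rewrite /nu addrAC subrr add0r.
have := tempered_derivative_series ab nu0 be0 (ltn0Sn _) cf tab.
rewrite nuE; apply: cvg_trans; apply: near_eq_cvg; apply: nearW => N.
rewrite /series /= big_mkord; apply: eq_bigr => m _; congr (_ * _).
rewrite /RL_integral ReD ReN Re_nat.
case: ltnP => mn.
  have le : (m%:R : R) <= complex.Re alpha.
    by apply: le_trans nal; rewrite ler_nat.
  rewrite ifF; last by apply/negbTE; rewrite -leNgt addrC subr_le0.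
  rewrite /RL_derivative.
  have -> : frac_order (- (- alpha + m%:R)) = (n - m)%N.
    apply: frac_order_eq; first by rewrite subn_gt0.
    have mn1 : (m <= n.-1)%N by rewrite -ltnS.
    rewrite -subn1 subnAC subn1 !natrB // ?(ltnW mn) //.
    rewrite opprD opprK ReD ReN Re_nat.
    by rewrite lerD2r nal /= ltrD2r.
  congr (iter _ _ (RL_integral_pos a _ f) t).
  by rewrite natrB ?(ltnW mn) // /nu; ring.
rewrite ifT // addrC subr_gt0.
by apply: lt_le_trans aln _; rewrite ler_nat.
Qed.

(** * Absolute convergence almost everywhere *)

Section AlmostEverywhere.
Variable R : realType.
Local Notation mu := (@lebesgue_measure R).
Implicit Types (D : set R) (k g : R -> R).

Lemma integrable_restrict D g : measurable D ->
  mu.-integrable D (fun x => (g x)%:E) ->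
  mu.-integrable setT (fun x => ((g \_ D) x)%:E).
Proof.
move=> mD gi.
rewrite (_ : (fun x => _) = (EFin \o g) \_ D).
  exact: (@integrable_mkcond _ (measurableTypeR R) R mu D (EFin \o g) mD).1 gi.
by apply/funext => x; rewrite /= !patchE; case: ifP.
Qed.

(** Tonelli: the double integral of [k(t - u) g(u)] is the product of the
    integrals of [k] and [g], hence finite. *)
Lemma convolution_integrable_ae k g :
  measurable_fun setT k -> measurable_fun setT g ->
  (forall x, 0 <= k x) -> (forall x, 0 <= g x) ->
  mu.-integrable setT (fun x => (k x)%:E) ->
  mu.-integrable setT (fun x => (g x)%:E) ->
  {ae mu, forall t, mu.-integrable setT (fun u => (k (t - u) * g u)%:E)}.
Proof.
move=> mk mg k0 g0 ik ig.
pose H (p : measurableTypeR R * measurableTypeR R) : \bar R :=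
  (k (p.1 - p.2) * g p.2)%:E.
have H0 p : (0 <= H p)%E by rewrite lee_fin mulr_ge0.
have mH : measurable_fun setT H.
  apply/measurable_EFinP; apply: measurable_funM; last first.
    exact: (measurableT_comp mg measurable_snd).
  apply: (measurableT_comp mk).
  by apply: measurable_funB; [exact: measurable_fst|exact: measurable_snd].
have inner u : (\int[mu]_t H (t, u) = (g u)%:E * \int[mu]_x (k x)%:E)%E.
  rewrite /H /=.
  under eq_integral do rewrite mulrC EFinM.
  rewrite ge0_integralZl_EFin //; last 2 first.
  - by move=> t _; rewrite lee_fin.
  - apply/measurable_EFinP; apply: (measurableT_comp mk).
    by apply: measurable_funB => //; exact: measurable_cst.
  congr (_ * _)%E; apply/esym.
  pose k' v := k (0 - v).
  have mk' : measurable_fun setT k'.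
    apply: (measurableT_comp mk).
    by apply: measurable_funB; [exact: measurable_cst|exact: measurable_id].
  rewrite (@ge0_integral_reflect R 0 setT (EFin \o k)) //; last 2 first.
  - by apply/measurable_EFinP; exact: mk.
  - by move=> x _ /=; rewrite lee_fin.
  rewrite preimage_setT (@ge0_integral_reflect R u setT (EFin \o k')) //; last 2 first.
  - by apply/measurable_EFinP; exact: mk'.
  - by move=> x _ /=; rewrite lee_fin; exact: k0.
  by rewrite preimage_setT; apply: eq_integral => t _; rewrite /k' /= sub0r opprB.
have iH : (mu \x mu)%E.-integrable setT H.
  apply/integrableP; split => //.
  under eq_integral do rewrite gee0_abs //.
  rewrite (@fubini_tonelli2 _ _ _ _ R mu mu H mH H0) /fubini_G.
  under eq_integral do rewrite inner.
  have Ik : (\int[mu]_x (k x)%:E)%E \is a fin_num by exact: integrable_fin_num.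
  have Ig : (\int[mu]_x (g x)%:E)%E \is a fin_num by exact: integrable_fin_num.
  rewrite ge0_integralZr //; last 3 first.
  - exact/measurable_EFinP.
  - by move=> u _; rewrite lee_fin.
  - by apply: integral_ge0 => x _; rewrite lee_fin.
  by rewrite -(fineK Ik) -(fineK Ig) -EFinM ltry.
exact: (ae_integrable1 iH).
Qed.

Lemma admissible_ae (a b r : R) (f : R -> R[i]^o) : 0 < r ->
  cintegrable `[a, b] f ->
  {ae mu, forall t, t \in `[a, b] -> admissible r f a t}.
Proof.
move=> r0 jf; have mab : measurable (`[a, b]%classic : set R) by [].
have mL : measurable (`]0, b - a]%classic : set R) by [].
(* For [t] in [a, b] the differences [t - u] range over ]0, b - a]. *)
pose k := (fun x : R => x `^ (r - 1)) \_ `]0, b - a].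
pose g := (fun u => norm1 (f u)) \_ `[a, b].
have ik : mu.-integrable setT (fun x => (k x)%:E).
  by apply: integrable_restrict => //; exact: integrable_powR.
have ig : mu.-integrable setT (fun x => (g x)%:E).
  by apply: integrable_restrict => //; exact: cintegrable_norm1.
have mk : measurable_fun setT k by apply/measurable_EFinP; exact: measurable_int ik.
have mg : measurable_fun setT g by apply/measurable_EFinP; exact: measurable_int ig.
have k0 x : 0 <= k x by rewrite /k patchE; case: ifP => // _; exact: powR_ge0.
have g0 x : 0 <= g x by rewrite /g patchE; case: ifP => // _; exact: norm1_ge0.
have := convolution_integrable_ae mk mg k0 g0 ik ig.
apply: (@filterS _ _ (ae_filter_ringOfSetsType mu)) => t jt.
rewrite in_itv /= => /andP[at_ tb].
have sub : `]a, t[ `<=` `[a, b].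
  move=> u /=; rewrite !in_itv /= => /andP[au ut].
  by rewrite !ltW // (lt_le_trans ut).
have mat := itv_oo_measurable a t.
split; first exact: cmeasurableS mab sub (cintegrable_measurable jf).
have jt' := @integrableS _ _ _ mu setT `]a, t[ _ measurableT mat (@subsetT _ _) jt.
apply: integrable_ext jt' => // u uat.
have ku : k (t - u) = (t - u) `^ (r - 1).
  rewrite /k patchE ifT // inE /= in_itv /=.
  move: uat; rewrite /= in_itv /= => /andP[au ut].
  by rewrite subr_gt0 ut /=; lra.
have gu : g u = norm1 (f u) by rewrite /g patchE ifT // inE; exact: sub.
by rewrite ku gu.
Qed.

End AlmostEverywhere.

Lemma T_integral_series (R : realType) (a b : R) (alpha beta : R[i])
    (f : R -> R[i]^o) (t : R) : 0 < complex.Re alpha -> 0 <= complex.Re beta ->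
  admissible (complex.Re alpha) f a t ->
  series (fun m : nat =>
    (- beta) ^+ m * cGamma (alpha + m%:R) / (m`!%:R * cGamma alpha)
    * RL_integral a b (alpha + m%:R) f t) @ \oo
  --> T_integral a alpha beta f t.
Proof.
move=> al0 be0 af; rewrite T_integral_conv.
rewrite (_ : series _ = fun N => (cGamma alpha)^-1 *
    \sum_(m < N) (- beta) ^+ (0 + m) / (0 + m)`!%:R *
      conv a (fun x => cpow x (alpha + m%:R - 1)) f t); last first.
  apply/funext => N.
  rewrite /series /= big_mkord mulr_sumr; apply: eq_bigr => m _.
  have alm : 0 < complex.Re (alpha + m%:R) by rewrite ReD Re_nat ltr_wpDr.
  rewrite add0n /RL_integral alm /RL_integral_pos.
  rewrite -/(conv a (fun x => cpow x (alpha + m%:R - 1)) f t).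
  rewrite cGamma_pochhammer //.
  have f0 : (m`!%:R : R[i]) != 0 by rewrite pnatr_eq0 -lt0n fact_gt0.
  have := pochhammer_neq0 m al0.
  (* If [cGamma alpha] were [0], both sides would be [0]. *)
  have [->|] := eqVneq (cGamma alpha : R[i]) 0.
    by rewrite !mulr0 invr0 mulr0 !mul0r.
  move: (conv _ _ _ _) (pochhammer _ _) (cGamma _) (m`!%:R : R[i]) f0.
  move=> X p c F F0 c0 p0.
  by field; rewrite F0 c0 p0.
by apply: cvg_complexZ; exact: conv_tempered_expansion.
Qed.

(** * Both expansions *)

Theorem theorem2p8 (R : realType) (a b : R) (hab : a < b) :
  (forall (alpha beta : R[i]) (f : R -> R[i]^o),
    0 < complex.Re alpha -> 0 <= complex.Re beta ->
    cintegrable `[a, b] f ->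
    {ae (@lebesgue_measure R), forall t, t \in `[a, b] ->
      series (fun m : nat =>
        (- beta) ^+ m * cGamma (alpha + m%:R) / (m`!%:R * cGamma alpha)
        * RL_integral a b (alpha + m%:R) f t) @ \oo
      --> T_integral a alpha beta f t})
  /\
  (forall (alpha beta : R[i]) (f : R -> R[i]^o),
    0 <= complex.Re alpha -> 0 <= complex.Re beta ->
    Cn_on (frac_order alpha) a b f ->
    forall t, t \in `]a, b] ->
      series (fun m : nat =>
        (- beta) ^+ m * pochhammer (- alpha) m / m`!%:R
        * RL_integral a b (- alpha + m%:R) f t) @ \oo
      --> T_derivative a b alpha beta f t).
Proof.
split=> [alpha beta f al0 be0 jf|alpha beta f al0 be0 cf t tab].
  have := admissible_ae al0 jf.
  apply: (@filterS _ _ (ae_filter_ringOfSetsType (@lebesgue_measure R))).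
  move=> t af tab.
  exact: T_integral_series al0 be0 (af tab).
exact: T_derivative_series.
Qed.
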